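(* Let $G$ be a compactly generated locally compact group with word length $|\cdot|_T$ associated to a compact generating set $T$. Suppose that there exist a continuous isometric representation $\pi : G \to \mathcal{O}(E)$ on a $q$-uniformly smooth Banach space $E$ ($1<q\le 2$) and a 1-cocycle $b \in Z^1(G,\pi)$ such that $$\rho_b(n) = \inf_{|g|_T = n} \|b(g)\|_E \succ n^{1/q}.$$ Then for every cohomologically adapted probability measure $\mu$ on $G$ with compact support $S$, the drift $l(\mu)$ of the random walk driven by $\mu$ is $0$, and $(G,\mu)$ has the Liouville property, that is, every continuous bounded $\mu$-harmonic function on $G$ is constant.
   Context: For a compact generating set $S$ of $G$, $|g|_S=\min\{n\in\mathbb{N}: g\in S^n\}$. The notation $\rho(n)\succ n^{1/q}$ means $n^{1/q}/\rho(n)\to0$ as $n\to\infty$. Banach spaces are real. $\mathcal{O}(E)$ is the group of linear isometries of $E$; $\pi$ is continuous if $(g,x)\mapsto\pi(g)x$ is continuous. A 1-cocycle for $\pi$ is a continuous map $b:G\to E$ with $b(gh)=b(g)+\pi(g)b(h)$; $Z^1(G,\pi)$ is the space of 1-cocycles. A Banach space $E$ is $q$-uniformly smooth if there is $D>0$ such that for all $x_0,x_1,z\in E$ and $t\in[0,1]$, with $x_t=(1-t)x_0+tx_1$: $\|z-x_t\|^q\ge(1-t)\|z-x_0\|^q+t\|z-x_1\|^q-D\,t(1-t)\|x_0-x_1\|^q$. Let $m_G$ be the Haar measure. A probability measure $\mu$ on $G$ is cohomologically adapted (with respect to a compact generating set $S$) if: $\mu$ is symmetric; $\mu$ is absolutely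 continuous with respect to $m_G$; the support of $\mu$ contains $S$; $\inf_{x\in S}\frac{d\mu}{dm_G}(x)>0$; and $\int_G|g|_S^r\,d\mu(g)<\infty$ for every $1\le r<\infty$. In the claim the support of $\mu$ is equal to the compact generating set $S$. Random walk: $X_n=\omega_1\cdots\omega_n$ with $\omega_i$ i.i.d. of law $\mu$. The drift is the almost sure limit $l(\mu)=\lim_n\frac{|X_n|_S}{n}=\lim_n\frac1n\int_G|g|_S\,d\mu^{*n}(g)$. A function $f$ on $G$ is $\mu$-harmonic if $f(g)=\int_G f(gh)\,d\mu(h)$ for all $g\in G$. *)

(* Defs.v *)
From HB Require Import structures.
From mathcomp Require Import all_boot all_order all_algebra finmap.
From mathcomp Require Import all_classical all_reals all_analysis.
From mathcomp Require Import measurable_realfun.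

Set Implicit Arguments.
Unset Strict Implicit.
Unset Printing Implicit Defensive.

Import Order.TTheory GRing.Theory Num.Theory.
Import numFieldNormedType.Exports.

Local Open Scope classical_set_scope.
Local Open Scope ring_scope.

HB.mixin Record isTopologicalGroup G & Group G & Topological G := {
  mulg_continuous : continuous (fun xy : G * G => (xy.1 * xy.2)%g);
  invg_continuous : continuous (fun x : G => x^-1%g)
}.

(* The distinguished point plays no role: it is only there because the
   library's sigma-algebras live on pointed types. *)
#[short(type="topGroupType")]
HB.structure Definition TopGroup :=
  {G of Group G & PointedTopological G & isTopologicalGroup G}.

(* G with its Borel sigma-algebra; convertible to G. *)
Notation borel G := (g_sigma_algebraType (@open G)).

Section WordLength.
Variable G : topGroupType.
Implicit Types S : set G.

Fixpoint setpow S (n : nat) : set G :=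
  if n is m.+1 then [set (x * y)%g | x in S & y in setpow S m] else [set 1%g].

(* No inverses are added: this is exactly what makes the word length finite.
   For symmetric S it says that S generates G as a group. *)
Definition generating S := forall g : G, exists n, setpow S n g.

(* The default value 0 is never used when S is generating. *)
Definition word_length S (g : G) : nat :=
  match pselect (exists n, `[< setpow S n g >]) with
  | left e => ex_minn e
  | right _ => 0%N
  end.

End WordLength.

Section Haar.
Variables (R : realType) (G : topGroupType).

Definition left_haar (m : {measure set (borel G) -> \bar R}) : Prop :=
  [/\ forall (g : G) (A : set (borel G)), measurable A ->
        m [set (g * x)%g | x in (A : set G)] = m A,
      m setT != 0%E,
      forall K : set G, compact K -> (m K < +oo)%E,
      forall A : set (borel G), measurable A ->
        m A = ereal_inf [set m U | U in [set U : set G | open U /\ A `<=` U]]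
    & forall U : set G, open U ->
        m U = ereal_sup [set m K | K in [set K : set G | compact K /\ K `<=` U]]].

End Haar.

Section Cocycles.
Variables (R : realType) (E : completeNormedModType R).

Definition uniformly_smooth (q : R) : Prop :=
  exists D : R, 0 < D /\
    forall (x0 x1 z : E) (t : R), 0 <= t <= 1 ->
      (1 - t) * `|z - x0| `^ q + t * `|z - x1| `^ q
        - D * t * (1 - t) * `|x0 - x1| `^ q
      <= `|z - ((1 - t) *: x0 + t *: x1)| `^ q.

Variable G : topGroupType.

(* Each pi g is automatically bijective, with inverse pi g^-1. *)
Definition continuous_isometric_rep (pi : G -> {linear E -> E}) : Prop :=
  [/\ forall x, pi 1%g x = x,
      forall g h x, pi (g * h)%g x = pi g (pi h x),
      forall g x, `|pi g x| = `|x|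
    & continuous (fun gx : G * E => pi gx.1 gx.2)].

Definition cocycle (pi : G -> {linear E -> E}) (b : G -> E) : Prop :=
  continuous b /\ forall g h, b (g * h)%g = b g + pi g (b h).

(* Extended real valued: it is +oo when no g has word length n. *)
Definition compression (T : set G) (b : G -> E) (n : nat) : \bar R :=
  ereal_inf [set `|b g|%:E | g in [set g | word_length T g = n]].

End Cocycles.

Section RandomWalk.
Variables (R : realType) (G : topGroupType).
Implicit Types (mu : probability (borel G) R) (S : set G).

Definition msupport mu : set G :=
  [set x | forall U : set G, open U -> U x -> (0 < mu U)%E].

(* The Radon-Nikodym derivative is only defined up to a null set: the
   condition on its infimum over S is read as holding for some version f. *)
Definition coh_adapted (m : {measure set (borel G) -> \bar R}) S mu : Prop :=
  (compact S /\ generating S) /\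
  [/\ forall A : set (borel G), measurable A ->
        mu ((fun x : G => x^-1%g) @^-1` A) = mu A,
      mu `<< m,
      S `<=` msupport mu,
      exists f : borel G -> \bar R,
        [/\ measurable_fun setT f,
            forall x, (0 <= f x)%E,
            forall A, measurable A -> mu A = (\int[m]_(x in A) f x)%E
          & (0 < ereal_inf [set f x | x in S])%E]
    & forall r : R, 1 <= r ->
        (\int[mu]_g ((word_length S g)%:R `^ r)%:E < +oo)%E].

Definition markov_op mu (f : G -> \bar R) (g : G) : \bar R :=
  (\int[mu]_(h in setT) f (g * h)%g)%E.

(* The integral of f against the n-th convolution power of mu, i.e. the
   iterated integral of f (h_1 * ... * h_n) in dmu(h_n) ... dmu(h_1).
   Iterated integrals are used because multiplication need not be measurable
   for the product of the Borel sigma-algebras if G is not second countable. *)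
Definition convolution_integral mu (n : nat) (f : G -> \bar R) : \bar R :=
  iter n (markov_op mu) f 1%g.

Definition iid_of_law mu d (Omega : measurableType d) (P : probability Omega R)
    (omega : nat -> Omega -> borel G) : Prop :=
  [/\ forall i, measurable_fun setT (omega i),
      forall i (A : set (borel G)), measurable A ->
        P (omega i @^-1` A) = mu A
    & forall (J : {fset nat}) (A : nat -> set (borel G)),
        (forall i, measurable (A i)) ->
        P (\bigcap_(i in [set` J]) (omega i @^-1` A i)) =
          (\prod_(i <- J) P (omega i @^-1` A i))%E].

Definition walk (Omega : Type) (omega : nat -> Omega -> borel G)
    (n : nat) (x : Omega) : G :=
  (\prod_(i < n) (omega i x : G))%g.

(* The almost sure limit is required on every probability space carrying an
   i.i.d. sequence of law mu. *)
Definition is_drift mu S (l : R) : Prop :=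
  (forall d (Omega : measurableType d) (P : probability Omega R)
      (omega : nat -> Omega -> borel G),
    iid_of_law mu P omega ->
    {ae P, forall x,
      ((word_length S (walk omega n x))%:R / n%:R : R) @[n --> \oo] --> l})
  /\
  ((n%:R^-1 : R)%:E *
     convolution_integral mu n (fun g => ((word_length S g)%:R)%:E))%E
    @[n --> \oo] --> l%:E.

Definition mu_harmonic mu (f : G -> R) : Prop :=
  forall g, markov_op mu (EFin \o f) g = (f g)%:E.

Definition liouville mu : Prop :=
  forall f : G -> R, continuous f -> (exists M : R, forall g, `|f g| <= M) ->
    mu_harmonic mu f -> exists c : R, forall g, f g = c.

End RandomWalk.

(* Main.v *)
Require Import Defs.
From HB Require Import structures.
From mathcomp Require Import all_boot all_order all_algebra finmap.
From mathcomp Require Import all_classical all_reals all_analysis.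
From mathcomp Require Import measurable_realfun.
From mathcomp Require Import ring lra.
Set Implicit Arguments.
Unset Strict Implicit.
Unset Printing Implicit Defensive.
Import Order.TTheory GRing.Theory Num.Theory.
Import numFieldNormedType.Exports.
Local Open Scope classical_set_scope.
Local Open Scope ring_scope.

(** The proof has two halves: a cocycle that grows faster than the q-th root
    of the length forces the walk to have zero speed, and zero speed forces
    bounded harmonic functions to be constant.

    Zero speed.  In a q-uniformly smooth space a martingale with bounded
    increments has q-th moment O(n).  The position b(X_n) of the walk under
    the cocycle is not a martingale, but it is the sum of a forward and of a
    backward martingale.  The usual way to see this centres the increments at
    the mean of b.  Here the mean is replaced by an independent copy of the
    step: increments become differences of two independent equidistributed
    vectors, and the two-point smoothness inequality at t = 1/2 applies to
    them directly, with no vector-valued integral (symmetric_step).  This gives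
    E |b(X_n)|^q = O(n) (markov_type).  The compression hypothesis turns it
    into: for every eps there is a continuous function phi >= |.| with
    E phi(X_n) <= A + eps n (speed_majorant).  The mean speed is therefore 0.
    For the almost sure statement the walk is cut into blocks of a fixed
    length; the length of X_(kn) is at most the sum of n independent copies of
    phi(X_k), and Chernoff's bound with Borel-Cantelli concludes
    (walk_ae_le).

    Liouville property.  Let f be bounded harmonic with f(1) = 0, and score a
    trajectory with steps h_1, h_2, ... against a point y by

      sum_j f(h_(j+1)) f(X_j^-1 y).

    For a fixed y this is a martingale with bounded increments, so it is
    larger than c n only with exponentially small probability (score_mgf).
    For y = X_n its mean is n times the variance of f(X_1), by harmonicity
    (score_mean).  At zero speed, X_n lies in a ball that is covered by
    e^(o(n)) translates of a neighbourhood U of 1.  An absolutely continuous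
    law moves continuously in total variation under translations, so f hardly
    changes inside a translate of U (harmonic_right_uniform).  A union bound
    over the translates contradicts the mean unless the variance of f(X_1)
    vanishes (harmonic_vanishes); then f(xs) = f(x) for all x and all s in the
    support, which generates the group.

    Multiplication on G need not be measurable for the product of the Borel
    sigma-algebras.  All computations with several steps are therefore made
    for finitely supported laws: a compact set on which a family of functions
    is equicontinuous splits into finitely many Borel classes on which these
    functions are nearly constant (finite_classification), and iterated
    integrals of the family are compared with finite sums over words in the
    classes. *)

(** * Expectations over finite words *)

Lemma ler_avg {R : realType} {K : finType} (p g : K -> R) (c : R) :
  \sum_k p k = 1 -> (forall k, g k <= p k * c) -> \sum_k g k <= c.
Proof. by move=> p1 gc; rewrite -[leRHS]mul1r -p1 big_distrl /= ler_sum. Qed.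

Section WordExpectation.
Context {R : realType} {K : finType}.
Variable p : K -> R.
Implicit Types (F : seq K -> R) (n : nat).

(** The expectation of F over words of n independent letters of law p.  The
    recursion removes the first letter; wexp_rcons removes the last one.  Having
    both is what makes a backward martingale as easy as a forward one. *)
Fixpoint wexp n F : R :=
  if n is m.+1 then \sum_k p k * wexp m (fun w => F (k :: w)) else F [::].

Lemma eq_wexp n F F' : (forall w, size w = n -> F w = F' w) ->
  wexp n F = wexp n F'.
Proof.
elim: n F F' => [|n IH] F F' FF' /=; first exact: FF'.
by apply: eq_bigr => k _; congr (_ * _); apply: IH => w sw; apply: FF' => /=; rewrite sw.
Qed.

Lemma wexpD n F F' : wexp n (fun w => F w + F' w) = wexp n F + wexp n F'.
Proof.
elim: n F F' => [//|n IH] F F' /=; rewrite -big_split /=.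
by apply: eq_bigr => k _; rewrite IH mulrDr.
Qed.

Lemma wexpZ n a F : wexp n (fun w => a * F w) = a * wexp n F.
Proof.
elim: n F => [//|n IH] F /=; rewrite big_distrr /=.
by apply: eq_bigr => k _; rewrite IH mulrCA.
Qed.

Lemma wexp0 n : wexp n (fun=> 0) = 0.
Proof. by elim: n => [//|n IH] /=; rewrite big1// => k _; rewrite IH mulr0. Qed.

Lemma wexp_sum n (I : Type) (r : seq I) (F : I -> seq K -> R) :
  wexp n (fun w => \sum_(i <- r) F i w) = \sum_(i <- r) wexp n (F i).
Proof.
elim: r => [|i r IH].
  rewrite big_nil -[RHS](wexp0 n).
  by apply: eq_wexp => w _; rewrite big_nil.
by rewrite big_cons -IH -wexpD; apply: eq_wexp => w _; rewrite big_cons.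
Qed.

Lemma wexp_rcons n F :
  wexp n.+1 F = wexp n (fun w => \sum_k p k * F (rcons w k)).
Proof.
elim: n F => [//|n IH] F.
transitivity (\sum_k p k * wexp n.+1 (fun w => F (k :: w))); first by [].
by under eq_bigr do rewrite IH.
Qed.

Lemma wexp_cat m n F :
  wexp (m + n) F = wexp m (fun u => wexp n (fun v => F (u ++ v))).
Proof.
elim: m F => [//|m IH] F /=.
by apply: eq_bigr => k _; rewrite IH.
Qed.

Hypothesis p_ge0 : forall k, 0 <= p k.

Lemma le_wexp n F F' : (forall w, size w = n -> F w <= F' w) ->
  wexp n F <= wexp n F'.
Proof.
elim: n F F' => [|n IH] F F' FF' /=; first exact: FF'.
apply: ler_sum => k _; apply: ler_wpM2l => //; apply: IH => w sw.
by apply: FF' => /=; rewrite sw.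
Qed.

Hypothesis p_sum1 : \sum_k p k = 1.

Lemma wexp_cst n a : wexp n (fun=> a) = a.
Proof.
elim: n => [//|n IH] /=.
by under eq_bigr do rewrite IH; rewrite -big_distrl /= p_sum1 mul1r.
Qed.

End WordExpectation.

(** * The moment bound for cocycles under a finitely supported law *)

Section SymmetricStep.
Context {R : realType} {E : normedModType R}.
Variables (q D B : R).
Hypothesis (q1 : 1 <= q) (D0 : 0 < D).
Local Notation F x := (`|x| `^ q).
Hypothesis smooth : forall u w : E,
  F (u + w) + F (u - w) <= 2 * F u + D / 2 * (2 * `|w|) `^ q.

Context {K : finType}.
Variables (p : K -> R) (beta : K -> E).
Hypothesis (p_ge0 : forall k, 0 <= p k) (p_sum1 : \sum_k p k = 1).
Hypothesis beta_le : forall k, `|beta k| <= B.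

(** Exchanging c and e changes the sign of the increment, so twice the left
    side is an average of |u + w|^q + |u - w|^q, to which two-point smoothness
    applies.  The constant comes from |w| <= 2 B. *)
Lemma symmetric_step (u : E) (T : {linear E -> E}) :
  (forall x, `|T x| = `|x|) ->
  \sum_c p c * (\sum_e p e * F (u + T (beta c - beta e)))
    <= F u + D / 4 * (4 * B) `^ q.
Proof.
move=> Tiso; set S := \sum_c _; set Q := D / 4 * _.
have S1 : S = \sum_c \sum_e (p c * p e) * F (u + T (beta c - beta e)).
  apply: eq_bigr => c _; rewrite big_distrr /=.
  by apply: eq_bigr => e _; rewrite mulrA.
have S2 : S = \sum_c \sum_e (p c * p e) * F (u - T (beta c - beta e)).
  rewrite S1 exchange_big /=; apply: eq_bigr => c _; apply: eq_bigr => e _.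
  by rewrite [p e * _]mulrC -linearN opprB.
suff : S + S <= 2 * (F u + Q) by lra.
rewrite [X in X + _]S1 [X in _ + X]S2 -big_split /=.
have -> : 2 * (F u + Q) = \sum_c \sum_e (p c * p e) * (2 * F u + 2 * Q).
  under eq_bigr do rewrite -big_distrl /= -big_distrr /= p_sum1 mulr1.
  by rewrite -big_distrl /= p_sum1 mul1r mulrDr.
apply: ler_sum => c _; rewrite -big_split /=; apply: ler_sum => e _.
rewrite -mulrDr ler_wpM2l ?mulr_ge0//.
apply: (le_trans (smooth _ _)); rewrite lerD2l.
have -> : 2 * Q = D / 2 * (4 * B) `^ q by rewrite /Q; field.
apply: ler_wpM2l; first by rewrite divr_ge0 ?ltW.
clear S1 S2 S Q; have BD : `|beta c - beta e| <= 2 * B.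
  have := ler_normB (beta c) (beta e).
  by have := beta_le c; have := beta_le e; lra.
have n0 := normr_ge0 (beta c - beta e).
by rewrite Tiso; apply: ge0_ler_powR; rewrite ?nnegrE ?(le_trans ler01 q1)//; lra.
Qed.
End SymmetricStep.

Definition wprod {G : groupType} {K : Type} (t : K -> G) (w : seq K) : G :=
  (\prod_(k <- w) t k)%g.

Lemma wprod_cons {G : groupType} {K : Type} (t : K -> G) k w :
  wprod t (k :: w) = (t k * wprod t w)%g.
Proof. exact: big_cons. Qed.

(** By |x + y| <= 2 max(|x|, |y|). *)
Lemma powR_normD {R : realType} {E : normedModType R} (q : R) (x y : E) :
  0 <= q -> `|x + y| `^ q <= 2 `^ q * (`|x| `^ q + `|y| `^ q).
Proof.
move=> q0; wlog xy : x y / `|x| <= `|y|.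
  move=> H; have [/H//|/ltW/H] := leP `|x| `|y|.
  by rewrite addrC [in leRHS]addrC.
apply: (@le_trans _ _ ((2 * `|y|) `^ q)).
  apply: ge0_ler_powR; rewrite ?nnegrE ?mulr_ge0//.
  by apply: (le_trans (ler_normD _ _)); lra.
by rewrite powRM// ler_wpM2l ?powR_ge0// lerDr powR_ge0.
Qed.

Fact even_length_arith (R : realType) (x y z oz W : R) : 0 <= y -> 1 <= x -> 0 <= z ->
  0 <= oz -> W <= x * (2 * z) -> W <= x * x * (oz + 2 * z + y).
Proof.
move=> y0 x1 z0 oz0 /le_trans; apply; rewrite -mulrA ler_wpM2l ?(le_trans ler01 x1)//.
by apply: (@le_trans _ _ (1 * (oz + 2 * z + y))); [lra|rewrite ler_wpM2r//; lra].
Qed.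

Fact odd_length_arith (R : realType) (x y z oz W : R) : 0 <= y -> 1 <= x -> 0 <= z ->
  0 <= oz -> W <= x * (2 * z) -> x * (y + W) <= x * x * (oz + 2 * z + y).
Proof.
move=> y0 x1 z0 oz0 Wz; rewrite -mulrA ler_wpM2l ?(le_trans ler01 x1)//.
apply: (@le_trans _ _ (x * y + x * (2 * z))); first by rewrite lerD// ler_peMl.
by rewrite -mulrDr ler_wpM2l ?(le_trans ler01 x1)//; lra.
Qed.

Section MarkovType.
Context {R : realType} {E : completeNormedModType R} {G : topGroupType}.
Variables (pi : G -> {linear E -> E}) (b : G -> E).
Hypotheses (rep_pi : continuous_isometric_rep pi) (cocycle_b : cocycle pi b).
Variables (q D B : R).
Hypothesis q1 : 1 <= q.
Hypothesis D0 : 0 < D.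
Local Notation F x := (`|x| `^ q).
Hypothesis smooth : forall u w : E,
  F (u + w) + F (u - w) <= 2 * F u + D / 2 * (2 * `|w|) `^ q.
Context {K : finType}.
Variables (p : K -> R) (t : K -> G) (iv : K -> K).
Hypotheses (p_ge0 : forall k, 0 <= p k) (p_sum1 : \sum_k p k = 1).
Hypotheses (iv_inj : injective iv) (p_iv : forall k, p (iv k) = p k).
Hypothesis t_iv : forall k, t (iv k) = (t k)^-1%g.
Hypothesis b_le : forall k, `|b (t k)| <= B.
Local Notation Q := (D / 4 * (4 * B) `^ q).

Let pi1 x : pi 1%g x = x. Proof. by case: rep_pi. Qed.
Let piM g h x : pi (g * h)%g x = pi g (pi h x). Proof. by case: rep_pi. Qed.
Let piN g x : `|pi g x| = `|x|. Proof. by case: rep_pi. Qed.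
Let bM g h : b (g * h)%g = b g + pi g (b h). Proof. by case: cocycle_b. Qed.
Let b1 : b 1%g = 0.
Proof. by apply: (addrI (b 1%g)); rewrite addr0 -{3}[1%g]mul1g bM pi1. Qed.
Let bV g : b g = - pi g (b g^-1%g).
Proof. by apply/eqP; rewrite -addr_eq0 -bM mulgV b1. Qed.

Local Notation K3 := (K * K * K)%type.
Let p3 (s : K3) := p s.1.1 * p s.1.2 * p s.2.

Let pairs (w : seq K3) : seq K := flatten [seq [:: s.1.1; s.1.2] | s <- w].

(** A letter (a, c, e) stands for two consecutive steps a, c and for a copy e
    of a step, independent of both.  With X the position before the two steps,
    the increment pi(X)(b(a) + pi(a) b(c)) of the cocycle equals
    pi(X a)(b(c) - b(a^-1)).  The copy splits it into
    pi(X a)(b(c) - b(e)), collected in fwd_part, and pi(X a)(b(e) - b(a^-1)),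
    collected in bwd_part. *)
Fixpoint fwd_part (w : seq K3) : E :=
  if w is s :: w' then
    pi (t s.1.1) (b (t s.1.2) - b (t s.2)) + pi (t s.1.1 * t s.1.2)%g (fwd_part w')
  else 0.

Fixpoint bwd_part (w : seq K3) : E :=
  if w is s :: w' then
    pi (t s.1.1) (b (t s.2) - b (t s.1.1)^-1%g) + pi (t s.1.1 * t s.1.2)%g (bwd_part w')
  else 0.

Lemma fwd_bwd w : b (wprod t (pairs w)) = fwd_part w + bwd_part w.
Proof.
elim: w => [|[[a c] e] w IH] /=; first by rewrite /wprod big_nil b1 addr0.
rewrite !wprod_cons mulgA bM IH /= addrACA -!linearD /= addrA subrK.
congr (_ + _); rewrite linearB /= bM addrC; congr (_ + _).
exact: bV.
Qed.

Lemma fwd_rcons w a c e : fwd_part (rcons w (a, c, e)) =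
  fwd_part w + pi (wprod t (pairs w) * t a)%g (b (t c) - b (t e)).
Proof.
elim: w => [|[[a' c'] e'] w IH] /=.
  by rewrite /wprod big_nil mul1g linear0 addr0 add0r.
by rewrite !wprod_cons IH [X in _ + X = _]linearD /= addrA -piM !mulgA.
Qed.

Let sum3 (f : K -> K -> K -> R) : \sum_(s : K3) f s.1.1 s.1.2 s.2
  = \sum_a \sum_c \sum_e f a c e.
Proof. by rewrite pair_bigA pair_bigA. Qed.

Let p3_ge0 s : 0 <= p3 s. Proof. by rewrite !mulr_ge0. Qed.
Let p3_sum1 : \sum_s p3 s = 1.
Proof.
rewrite /p3 (sum3 (fun a c e => p a * p c * p e)).
under eq_bigr do under eq_bigr do rewrite -big_distrr /= p_sum1 mulr1.
by under eq_bigr do rewrite -big_distrr /= p_sum1 mulr1.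
Qed.

(** The last letter contributes an increment that is symmetric given the
    past. *)
Lemma wexp_fwd m : wexp p3 m (fun w => F (fwd_part w)) <= m%:R * Q.
Proof.
elim: m => [|m IH]; first by rewrite /= mul0r normr0 powR0 // gt_eqF // (lt_le_trans
  ltr01 q1).
rewrite wexp_rcons -natr1 mulrDl mul1r.
apply: (@le_trans _ _ (wexp p3 m (fun w => F (fwd_part w) + Q))).
  apply: le_wexp => // w _.
  pose f a c e := p a * p c * p e * F (fwd_part w +
    pi (wprod t (pairs w) * t a)%g (b (t c) - b (t e))).
  rewrite (eq_bigr (fun s : K3 => f s.1.1 s.1.2 s.2)); last first.
    by move=> [[a c] e] _; rewrite fwd_rcons.
  rewrite sum3 /f.
  apply: (ler_avg p_sum1) => a.
  apply: (le_trans _ (ler_wpM2l (p_ge0 a) (symmetric_step q1 D0 smooth p_ge0 p_sum1 b_le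
    (fwd_part w) (piN (wprod t (pairs w) * t a)%g)))).
  rewrite big_distrr /= ler_sum// => c _; rewrite !big_distrr /= ler_sum // => e _.
  by rewrite !mulrA.
by rewrite wexpD wexp_cst // lerD2r.
Qed.

(** The same with time reversed: the first letter is symmetric given the
    future, because a^-1 and e have the same law. *)
Lemma wexp_bwd m : wexp p3 m (fun w => F (bwd_part w)) <= m%:R * Q.
Proof.
elim: m => [|m IH]; first by rewrite /= mul0r normr0 powR0 // gt_eqF // (lt_le_trans
  ltr01 q1).
rewrite /= -natr1 mulrDl mul1r.
under eq_bigr do rewrite -wexpZ.
rewrite -wexp_sum.
apply: (@le_trans _ _ (wexp p3 m (fun w => F (bwd_part w) + Q))); last first.
  by rewrite wexpD wexp_cst // lerD2r.
apply: le_wexp => // w _.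
rewrite /p3 (sum3 (fun a c e => p a * p c * p e * F (pi (t a) (b (t e) - b (t a)^-1%g)
   + pi (t a * t c)%g (bwd_part w)))).
rewrite exchange_big /=; apply: (ler_avg p_sum1) => c.
have := symmetric_step q1 D0 smooth p_ge0 p_sum1 b_le (pi (t c) (bwd_part w)) (piN 1%g).
rewrite piN => /(ler_wpM2l (p_ge0 c)); apply: le_trans; rewrite le_eqVlt; apply/orP; left.
apply/eqP; rewrite (reindex_inj iv_inj) /=.
under [in RHS]eq_bigr do rewrite big_distrr /=.
rewrite exchange_big /= big_distrr /=; apply: eq_bigr => e _.
rewrite big_distrr /=; apply: eq_bigr => a _.
rewrite p_iv t_iv invgK piM -linearD piN pi1 addrC.
by ring.
Qed.

(** The extra copies integrate to 1. *)
Lemma wexp_pairs m (H : seq K -> R) :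
  wexp p m.*2 H = wexp p3 m (fun w => H (pairs w)).
Proof.
elim: m H => [//|m IH] H.
pose f a c e := p a * p c * p e * wexp p m.*2 (fun w => H [:: a, c & w]).
rewrite doubleS; transitivity (\sum_a \sum_c \sum_e f a c e).
  rewrite /=; apply: eq_bigr => a _; rewrite big_distrr /=; apply: eq_bigr => c _.
  rewrite /f; under eq_bigr do rewrite -mulrA mulrCA.
  by rewrite -big_distrl /= p_sum1 mul1r mulrA.
by rewrite -sum3 /=; apply: eq_bigr => s _; rewrite /f IH.
Qed.

Lemma markov_type_even m :
  wexp p m.*2 (fun w => F (b (wprod t w))) <= 2 `^ q * (2 * m%:R * Q).
Proof.
rewrite wexp_pairs.
apply: (@le_trans _ _ (wexp p3 m (fun w => 2 `^ q * (F (fwd_part w) + F (bwd_part w))))).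
  apply: le_wexp => // w _; rewrite fwd_bwd.
  by apply: powR_normD; apply: (le_trans ler01 q1).
rewrite wexpZ ler_wpM2l ?powR_ge0 // wexpD.
by have := wexp_fwd m; have := wexp_bwd m; lra.
Qed.

(** Odd lengths are reduced to even ones by removing the first step; this costs
    the second factor 2^q. *)
Lemma markov_type n :
  wexp p n (fun w => F (b (wprod t w))) <= 4 `^ q * (n%:R * Q + B `^ q).
Proof.
have q0 : 0 <= q by apply: (le_trans ler01 q1).
have Bn (k : K) : 0 <= B by exact: le_trans (normr_ge0 _) (b_le k).
have Q0 : 0 <= Q by rewrite mulr_ge0 ?powR_ge0 ?divr_ge0 ?ltW.
have B0 : 0 <= B `^ q by apply: powR_ge0.
have -> : (4 : R) `^ q = 2 `^ q * 2 `^ q.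
  by rewrite -powRM//; congr (_ `^ q); ring.
have x1 : 1 <= (2 : R) `^ q.
  by rewrite -[leLHS](powRr0 2) ler_powR // ler1n.
rewrite -(odd_double_half n); move: (odd n) n./2 => o m.
have mQ : 0 <= m%:R * Q by rewrite mulr_ge0.
have {}Q0 : 0 <= (o : nat)%:R * Q by rewrite mulr_ge0.
have H : wexp p m.*2 (fun w => F (b (wprod t w))) <= 2 `^ q * (2 * (m%:R * Q)).
  by have := markov_type_even m; rewrite !mulrA.
rewrite natrD -muln2 natrM mulrDl [_ * 2%:R]mulrC -[2%:R * _ * _]mulrA muln2.
move: B0 x1 mQ Q0 H; move: (_%:R * Q) (_%:R * Q) => z oz.
case: o => /=; last first.
  rewrite add0n; move: (B `^ q) (2 `^ q) (wexp _ _ _) => y x W.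
  exact: even_length_arith.
move=> B0 x1 mQ Q0 H.
apply: (@le_trans _ _ (2 `^ q * (B `^ q + wexp p m.*2 (fun w => F (b (wprod t w)))))).
  apply: (ler_avg p_sum1) => k; rewrite ler_wpM2l // -[X in _ <= _ * (X + _)](wexp_cst
    p_sum1 m.*2).
  rewrite -wexpD -wexpZ; apply: le_wexp => // w _; rewrite wprod_cons bM.
  apply: (le_trans (powR_normD _ _ _)) => //=.
  rewrite piN ler_wpM2l ?powR_ge0// lerD2r.
  by apply: ge0_ler_powR; rewrite ?nnegrE// (Bn k).
move: B0 x1 mQ Q0 H; move: (B `^ q) (2 `^ q) (wexp _ _ _) => y x W.
exact: odd_length_arith.
Qed.

End MarkovType.

(** * Scores of bounded harmonic functions *)

Lemma expR_le_quadratic (R : realType) (x : R) : `|x| <= 2^-1 ->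
  expR x <= 1 + x + 2 * x ^+ 2.
Proof.
move=> /ler_normlP[x1 x2].
have e0 : 0 < expR (- x) by exact: expR_gt0.
have := expR_ge1Dx (- x) => e1.
rewrite -[x in expR x]opprK expRN -[leLHS]mul1r ler_pdivrMr //.
apply: (@le_trans _ _ ((1 + x + 2 * x ^+ 2) * (1 - x))).
  have : 0 <= x ^+ 2 * (1 - 2 * x) by rewrite mulr_ge0 ?sqr_ge0//; lra.
  by lra.
by rewrite ler_wpM2l //; have := sqr_ge0 x; have := sqr_ge0 (x + 1); nra.
Qed.

Section Score.
Context {R : realType} {G : topGroupType} {K : finType}.
Variables (p : K -> R) (t : K -> G) (f : G -> R).

(** A statistic that detects whether the endpoint y remembers the steps of w.
    Each step k adds f(t k) times the value of f at the endpoint, as seen from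
    the position before that step. *)
Fixpoint score (w : seq K) (y : G) : R :=
  if w is k :: w' then f (t k) * f y + score w' ((t k)^-1 * y)%g else 0.

Hypotheses (p_ge0 : forall k, 0 <= p k) (p_sum1 : \sum_k p k = 1).
Hypothesis f_le1 : forall g, `|f g| <= 1.

Lemma score_le w y : score w y <= (size w)%:R.
Proof.
elim: w y => [//|k w IH] y /=; rewrite -natr1 addrC lerD//.
apply: (le_trans (ler_norm _)); rewrite normrM.
by rewrite -[leRHS]mulr1 ler_pM.
Qed.

Lemma score_near (delta : R) w y y' :
  (forall z, `|f (z * y)%g - f (z * y')%g| <= delta) ->
  score w y <= score w y' + (size w)%:R * delta.
Proof.
elim: w y y' => [|k w IH] y y' yy' /=; first by rewrite mul0r addr0.
rewrite -natr1 mulrDl mul1r.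
have {}IH := IH ((t k)^-1 * y)%g ((t k)^-1 * y')%g.
have /IH{}IH : forall z, `|f (z * ((t k)^-1 * y))%g - f (z * ((t k)^-1 * y'))%g| <= delta.
  by move=> z; rewrite !mulgA.
have : f (t k) * f y - f (t k) * f y' <= delta.
  rewrite -mulrBr; apply: (le_trans (ler_norm _)); rewrite normrM -[leRHS]mul1r.
  by rewrite ler_pM//; have := yy' 1%g; rewrite !mul1g.
by move: IH; lra.
Qed.

(** For a fixed y, the factor f(X_j^-1 y) is known before the step that it
    multiplies, and that step has almost zero mean. *)
Lemma score_mgf (lam : R) n y : 0 <= lam <= 2^-1 ->
  `|\sum_k p k * f (t k)| <= lam ->
  wexp p n (fun w => expR (lam * score w y)) <= (1 + 3 * lam ^+ 2) ^+ n.
Proof.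
move=> /andP[lam0 lam12] mean.
have c0 : 0 <= 1 + 3 * lam ^+ 2 by have := sqr_ge0 lam; lra.
elim: n y => [|n IH] y; first by rewrite /= mulr0 expR0 expr0.
rewrite [leLHS]/= exprS.
apply: (@le_trans _ _ (\sum_k (p k * expR (lam * (f (t k) * f y))) * (1 + 3 * lam ^+ 2)
  ^+ n)).
  apply: ler_sum => k _; rewrite -mulrA ler_wpM2l//.
  under eq_wexp do rewrite mulrDr expRD.
  by rewrite wexpZ ler_wpM2l ?expR_ge0.
rewrite -big_distrl /= ler_wpM2r ?exprn_ge0//.
apply: (@le_trans _ _ (\sum_k (p k + (p k * f (t k)) * (lam * f y) + p k * (2 * lam ^+
  2)))).
  apply: ler_sum => k _.
  have -> : p k + p k * f (t k) * (lam * f y) + p k * (2 * lam ^+ 2) =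
     p k * (1 + lam * (f (t k) * f y) + 2 * lam ^+ 2) by ring.
  rewrite ler_wpM2l//.
  have ff1 : `|f (t k) * f y| <= 1 by rewrite normrM -[leRHS]mulr1 ler_pM.
  have lff : `|lam * (f (t k) * f y)| <= lam.
    by rewrite normrM ger0_norm// -[leRHS]mulr1 ler_wpM2l.
  apply: (le_trans (expR_le_quadratic (le_trans lff lam12))); rewrite lerD2l.
  by rewrite ler_wpM2l// -[leLHS]ger0_norm ?sqr_ge0// normrX lerXn2r // nnegrE.
rewrite !big_split /= -!big_distrl /= p_sum1 mul1r.
have : (\sum_k p k * f (t k)) * (lam * f y) <= lam * lam.
  apply: (le_trans (ler_norm _)); rewrite normrM ler_pM// normrM ger0_norm//.
  by rewrite -[leRHS]mulr1 ler_wpM2l.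
rewrite expr2; lra.
Qed.

(** At the true endpoint, averaging over the later steps replaces
    f(X_j^-1 X_n) by f(t k), up to eps, where k is the next step.  The score
    then gains f(t k)^2 per step. *)
Lemma score_mean (eps : R) n :
  (forall m k, (m < n)%N -> `|wexp p m (fun w => f (t k * wprod t w)%g) - f (t k)| <=
    eps) ->
  n%:R * (\sum_k p k * f (t k) ^+ 2 - eps) <= wexp p n (fun w => score w (wprod t w)).
Proof.
elim: n => [|n IH] H; first by rewrite mul0r.
rewrite -natr1 mulrDl mul1r /=.
apply: (@le_trans _ _ (\sum_k (p k * f (t k) ^+ 2 - p k * eps +
    p k * wexp p n (fun w => score w (wprod t w))))).
  rewrite !big_split /= sumrN -!big_distrl /= p_sum1 !mul1r.
  by rewrite [leLHS]addrC lerD2l; apply: IH => m k mn; apply: H; rewrite ltnW.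
apply: ler_sum => k _; rewrite -mulrBr -mulrDr ler_wpM2l//.
under [leRHS]eq_wexp do rewrite wprod_cons mulKg.
rewrite wexpD lerD2r wexpZ.
have : f (t k) * (f (t k) - wexp p n (fun w => f (t k * wprod t w)%g)) <= eps.
  apply: (le_trans (ler_norm _)); rewrite normrM -[leRHS]mul1r ler_pM//.
  by rewrite distrC H.
by rewrite mulrBr -expr2; lra.
Qed.

(** The set B j stands for the positions reachable in j steps: the approximate
    mean value property is only available on a bounded set. *)
Lemma wexp_near_harmonic (B : nat -> set G) (eta : R) n x N :
  (forall j x k, B j x -> B j.+1 (x * t k)%g) ->
  (forall x, B N x -> `|\sum_k p k * f (x * t k)%g - f x| <= eta) ->
  (forall j x, B j x -> (j <= N)%N -> B N x) ->
  forall j, (j + n <= N)%N -> B j x ->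
  `|wexp p n (fun w => f (x * wprod t w)%g) - f x| <= n%:R * eta.
Proof.
move=> Bt fN BN; elim: n x => [|n IH] x j jnN Bx.
  by rewrite /= /wprod big_nil mulg1 subrr normr0 mul0r.
rewrite -natr1 mulrDl mul1r /=.
have -> : \sum_k p k * wexp p n (fun w => f (x * wprod t (k :: w))%g) - f x =
    \sum_k p k * (wexp p n (fun w => f ((x * t k) * wprod t w)%g) - f (x * t k)%g)
    + (\sum_k p k * f (x * t k)%g - f x).
  rewrite addrA -big_split /=; congr (_ - _); apply: eq_bigr => k _.
  rewrite -mulrDr subrK; congr (_ * _); apply: eq_wexp => w _.
  by rewrite wprod_cons mulgA.
apply: (le_trans (ler_normD _ _)); rewrite lerD//; last first.
  by apply: fN; apply: BN Bx _; apply: leq_trans jnN; rewrite leq_addr.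
apply: (le_trans (ler_norm_sum _ _ _)).
apply: (ler_avg p_sum1) => k; rewrite normrM ger0_norm// ler_wpM2l//.
by apply: (IH _ j.+1); [rewrite addSnnS|exact: Bt].
Qed.

(** The union bound.  The penalty psi replaces the indicator of the event that
    the endpoint is far away: when psi >= n it outweighs the score, which is at
    most n; otherwise the score is compared with the score at a point of ys.
    The left side comes from 1 + x <= exp x. *)
Lemma score_contradiction (psi : G -> R) (ys : seq G) (lam delta tau : R) n :
  (forall g, 0 <= psi g) ->
  0 <= lam <= 2^-1 -> `|\sum_k p k * f (t k)| <= lam ->
  (forall w, size w = n -> n%:R <= psi (wprod t w) \/
    exists2 y, y \in ys & forall z, `|f (z * wprod t w)%g - f (z * y)%g| <= delta) ->
  1 + lam * (wexp p n (fun w => score w (wprod t w))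
      - wexp p n (fun w => psi (wprod t w)) - n%:R * tau) <=
  expR (- (lam * n%:R * tau)) *
    (1 + (size ys)%:R * expR (lam * n%:R * delta) * (1 + 3 * lam ^+ 2) ^+ n).
Proof.
move=> psi0 lam12 mean cover; have /andP[lam0 _] := lam12.
pose T w := lam * (score w (wprod t w) - psi (wprod t w)).
apply: (@le_trans _ _ (wexp p n (fun w => expR (- (lam * n%:R * tau)) * expR (T w)))).
  apply: (@le_trans _ _ (wexp p n (fun w => (1 - lam * n%:R * tau) + T w))); last first.
    apply: le_wexp => // w _; rewrite -expRD.
    by apply: le_trans (expR_ge1Dx _); rewrite addrA.
  rewrite wexpD wexp_cst// /T wexpZ.
  under [X in _ <= _ + lam * X]eq_wexp do rewrite -mulN1r.
  by rewrite wexpD wexpZ; lra.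
rewrite wexpZ ler_wpM2l ?expR_ge0//.
apply: (@le_trans _ _ (wexp p n (fun w => 1 + expR (lam * n%:R * delta) *
    \sum_(y <- ys) expR (lam * score w y)))).
  apply: le_wexp => // w sw; have [big|[y yys near]] := cover w sw.
    apply: (@le_trans _ _ 1).
      rewrite -expR0 ler_expR /T -[leRHS](mulr0 lam) ler_wpM2l// subr_le0.
      by apply: le_trans big; rewrite -sw score_le.
    by rewrite lerDl mulr_ge0 ?expR_ge0// sumr_ge0// => y _; exact: expR_ge0.
  apply: (@le_trans _ _ (expR (lam * n%:R * delta) * expR (lam * score w y))).
    rewrite -expRD ler_expR /T -mulrA -mulrDr ler_wpM2l//.
    have := score_near w near; have := psi0 (wprod t w); rewrite sw; lra.
  rewrite -[leLHS]add0r lerD// ler_wpM2l ?expR_ge0// (big_rem _ yys) /= lerDl.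
  by rewrite sumr_ge0// => ? _; exact: expR_ge0.
rewrite wexpD wexp_cst// lerD2l wexpZ wexp_sum.
rewrite [leRHS]mulrAC [leRHS]mulrC ler_wpM2l ?expR_ge0//.
apply: (@le_trans _ _ (\sum_(y <- ys) (1 + 3 * lam ^+ 2) ^+ n)).
  by apply: ler_sum => y _; exact: score_mgf.
by rewrite big_const_seq count_predT iter_addr_0 [leRHS]mulr_natl.
Qed.

End Score.

(** * Integrals compared with finite sums over classes *)

Section ClassIntegral.
Context d (T : measurableType d) (R : realType).

(** The integral of a nonnegative function is a supremum over the simple
    functions below it, hence monotone without any measurability.  The iterates
    of the Markov operator applied to a word length need this. *)
Lemma ge0_le_integral_nonmeasurable (mu : {measure set T -> \bar R}) (f g : T -> \bar R) :
  (forall x, (0 <= f x)%E) -> (forall x, (f x <= g x)%E) ->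
  (\int[mu]_x f x <= \int[mu]_x g x)%E.
Proof.
move=> f0 fg; have g0 x : (0 <= g x)%E by exact: le_trans (f0 x) (fg x).
rewrite !ge0_integralTE//; apply: le_ereal_sup => _ [h hf <-].
by exists h => // x; exact: le_trans (hf x) (fg x).
Qed.

Variables (mu : probability T R) (K : finType) (c : T -> K).
Hypothesis mc : forall k, measurable (c @^-1` [set k]).

Definition class_mass (k : K) : R := fine (mu (c @^-1` [set k])).

Lemma class_mass_ge0 k : 0 <= class_mass k.
Proof. by rewrite fine_ge0. Qed.

Lemma class_massE k : (class_mass k)%:E = mu (c @^-1` [set k]).
Proof. by rewrite fineK// fin_num_measure. Qed.

Lemma measurable_class (dS : measure_display) (U : measurableType dS) (v : K -> U) :
  measurable_fun setT (v \o c).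
Proof.
move=> mT Y mY; rewrite setTI.
rewrite [X in measurable X](_ : _ = \bigcup_(k in [set k | Y (v k)]) (c @^-1` [set k])).
  apply: fin_bigcup_measurable => //; exact: finite_finset.
by apply/seteqP; split=> [x Yx|x [k /= Yk ck]]; [exists (c x)|rewrite /= ck].
Qed.

Lemma integral_class (v : K -> R) : (forall k, 0 <= v k) ->
  (\int[mu]_x (v (c x))%:E = (\sum_k class_mass k * v k)%:E)%E.
Proof.
move=> v0; transitivity (\int[mu]_x (\sum_(k <- index_enum K)
    (v k)%:E * (\1_(c @^-1` [set k]) x)%:E))%E.
  apply: eq_integral => x _; rewrite (bigD1 (c x)) //= indicE mem_set// mule1.
  rewrite big1 ?adde0// => k /negP kx; rewrite indicE memNset ?mule0//= => cx.
  by apply: kx; rewrite -cx.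
rewrite ge0_integral_sum//; last 2 first.
- by move=> k; apply: measurable_funeM; apply/measurable_EFinP; exact: measurable_indic.
- by move=> k x _; rewrite mule_ge0 ?lee_fin.
rewrite -sumEFin; apply: eq_bigr => k _.
rewrite ge0_integralZl_EFin //.
- by rewrite integral_indic// setIT EFinM class_massE muleC.
- by apply/measurable_EFinP; exact: measurable_indic.
Qed.

Lemma class_mass_sum1 : \sum_k class_mass k = 1.
Proof.
have := integral_class (fun=> ler01); rewrite integral_cst// mul1e => H.
apply: EFin_inj; rewrite -[RHS](@probability_setT _ _ _ mu); apply: esym.
by apply: etrans H _; congr EFin; apply: eq_bigr => k _; rewrite mulr1.
Qed.

Variable D : set T.
Hypotheses (mD : measurable D) (D1 : mu (~` D) = 0).

(** Off D the majorant takes the value +oo, which costs nothing. *)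
Lemma integral_le_class (g : T -> \bar R) (v : K -> R) :
  (forall x, (0 <= g x)%E) -> (forall k, 0 <= v k) ->
  (forall x, D x -> (g x <= (v (c x))%:E)%E) ->
  (\int[mu]_x g x <= (\sum_k class_mass k * v k)%:E)%E.
Proof.
move=> g0 v0 gv; rewrite -integral_class//.
pose h x : \bar R := if x \in D then (v (c x))%:E else +oo%E.
have mh : measurable_fun setT h.
  apply: measurable_fun_ifT => //.
    by apply: (measurable_fun_bool true); rewrite setTI preimage_mem_true.
  by apply/measurable_EFinP; exact: (measurable_class v).
have h0 x : (0 <= h x)%E by rewrite /h; case: ifP => _; rewrite ?lee_fin ?leey.
apply: (@le_trans _ _ (\int[mu]_x h x)%E).
  apply: ge0_le_integral_nonmeasurable => // x; rewrite /h.
  by case: ifPn => [/set_mem/gv//|_]; rewrite leey.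
rewrite -{1}(setUv D) ge0_integral_setU//; last 3 first.
- exact: measurableC.
- exact: measurable_funTS.
- by apply/disj_setPS; rewrite setICr.
rewrite (null_set_integral (measurableC mD) _ D1) ?adde0; last exact: measurable_funTS.
apply: (@le_trans _ _ (\int[mu]_(x in D) (v (c x))%:E)%E).
  rewrite le_eqVlt; apply/orP; left; apply/eqP; apply: eq_integral => x xD.
  by rewrite /h xD.
apply: ge0_subset_integral => //.
  by apply/measurable_EFinP; exact: (measurable_class v).
by move=> x _; rewrite lee_fin.
Qed.

Lemma integral_ge_class (g : T -> \bar R) (v : K -> R) :
  (forall x, (0 <= g x)%E) ->
  (forall x, D x -> ((v (c x))%:E <= g x)%E) ->
  ((\sum_k class_mass k * v k)%:E <= \int[mu]_x g x)%E.
Proof.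
move=> g0 gv; pose v' k := Num.max 0 (v k).
have v'0 k : 0 <= v' k by rewrite le_max lexx.
apply: (@le_trans _ _ (\sum_k class_mass k * v' k)%:E).
  rewrite lee_fin ler_sum// => k _; rewrite ler_wpM2l ?class_mass_ge0//.
  by rewrite le_max lexx orbT.
rewrite -integral_class//.
have mv : measurable_fun setT (fun x => (v' (c x))%:E).
  by apply/measurable_EFinP; exact: (measurable_class v').
rewrite -{1}(setUv D) ge0_integral_setU//; last 4 first.
- exact: measurableC.
- exact: measurable_funTS.
- by move=> x _; rewrite lee_fin.
- by apply/disj_setPS; rewrite setICr.
rewrite (null_set_integral (measurableC mD) _ D1) ?adde0; last exact: measurable_funTS.
rewrite integral_mkcond; apply: ge0_le_integral_nonmeasurable => x; rewrite /patch.
  by case: ifP => // _; rewrite lee_fin.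
case: ifPn => [/set_mem Dx|//]; rewrite /v' EFin_max ge_max g0/=; exact: gv.
Qed.

End ClassIntegral.

(** * Borel sets, continuity and word length *)

Section BorelMeasurability.
Context {R : realType} {G : topGroupType}.

Lemma open_borel_measurable (U : set G) : open U -> measurable (U : set (borel G)).
Proof. by move=> oU; apply: sub_sigma_algebra. Qed.

Lemma closed_borel_measurable (U : set G) : closed U -> measurable (U : set (borel G)).
Proof.
move=> cU; rewrite -[U]setCK; apply: measurableC.
by apply: open_borel_measurable; rewrite openC.
Qed.

Lemma compact_borel_measurable (U : set G) : hausdorff_space G -> compact U ->
  measurable (U : set (borel G)).
Proof. by move=> hG cU; apply: closed_borel_measurable; exact: compact_closed. Qed.

Lemma continuous_borel_measurable (f : G -> R) : continuous f ->
  measurable_fun setT (f : borel G -> R).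
Proof.
move=> cf; apply: (measurability _ (RGenOpens.measurableE R)).
move=> _ [_ [x [y ->]] <-]; rewrite setTI; apply: open_borel_measurable.
by apply: open_comp; [move=> z _; exact: cf|exact: interval_open].
Qed.

Lemma continuous_borel_preimage (f : G -> G) (A : set G) : continuous f ->
  measurable (A : set (borel G)) -> measurable (f @^-1` A : set (borel G)).
Proof.
move=> cf mA; rewrite -[X in measurable X]setTI.
have mf : measurable_fun setT (f : borel G -> borel G).
  apply: (@measurability _ _ (borel G) (borel G) _ _ (@open G)) => // _ [U oU <-].
  rewrite setTI.
  by apply: open_borel_measurable; apply: open_comp => // z _; exact: cf.
exact: mf.
Qed.

End BorelMeasurability.

Section GroupTopology.
Context {G : topGroupType}.

Lemma mulg_cont2 (T : topologicalType) (f g : T -> G) :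
  continuous f -> continuous g -> continuous (fun x => (f x * g x)%g).
Proof.
move=> cf cg x.
have := @cvg_comp T (G * G)%type G (fun x => (f x, g x)) (fun xy : G * G => (xy.1 * xy.2)%g)
  (nbhs x) (nbhs (f x, g x)) (nbhs (f x * g x)%g).
by apply; [apply: cvg_pair; [exact: cf|exact: cg]|exact: (@mulg_continuous G (f x, g x))].
Qed.

Lemma invg_cont (T : topologicalType) (f : T -> G) :
  continuous f -> continuous (fun x => (f x)^-1%g).
Proof. move=> cf x; apply: (@cvg_comp _ _ _ f); [exact: cf|exact: invg_continuous]. Qed.

Lemma cst_cont (T U : topologicalType) (a : U) : continuous (fun _ : T => a).
Proof. by move=> x; exact: cvg_cst. Qed.

Lemma id_cont (T : topologicalType) : continuous (fun x : T => x).
Proof. by move=> x; exact: cvg_id. Qed.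

Lemma fst_cont (T U : topologicalType) : continuous (@fst T U).
Proof. by move=> x; exact: cvg_fst. Qed.

Lemma snd_cont (T U : topologicalType) : continuous (@snd T U).
Proof. by move=> x; exact: cvg_snd. Qed.

Lemma mulgl_cont (g : G) : continuous (fun x => (g * x)%g).
Proof. by apply: mulg_cont2; [exact: cst_cont|exact: id_cont]. Qed.

Lemma sandwich_continuous {R : realType} (phi : G -> R) : continuous phi ->
  continuous (fun z : G * (G * G) => phi (z.2.1 * z.1 * z.2.2)%g).
Proof.
move=> cphi z; apply: (@continuous_comp _ _ _
  (fun z : G * (G * G) => z.2.1 * z.1 * z.2.2)%g phi); last exact: cphi.
have cfst : continuous (fun z : G * (G * G) => z.1) by exact: fst_cont.
have csnd : continuous (fun z : G * (G * G) => z.2) by exact: snd_cont.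
have csndfst : continuous (fun z : G * (G * G) => z.2.1).
  by move=> y; apply: (@continuous_comp _ _ _ _ fst); [exact: csnd|exact: fst_cont].
have csndsnd : continuous (fun z : G * (G * G) => z.2.2).
  by move=> y; apply: (@continuous_comp _ _ _ _ snd); [exact: csnd|exact: snd_cont].
exact: (mulg_cont2 (mulg_cont2 csndfst cfst) csndsnd).
Qed.

Lemma compact_mulg (A B : set G) : compact A -> compact B ->
  compact [set (x * y)%g | x in A & y in B].
Proof.
move=> cA cB.
have -> : [set (x * y)%g | x in A & y in B] = (fun xy : G * G => (xy.1 * xy.2)%g) @` (A
  `*` B).
  apply/seteqP; split=> [_ [x Ax [y By <-]]|_ [[x y] [/= Ax By] <-]]; first by exists (x,
    y).
  by exists x => //; exists y.
apply: continuous_compact; last exact: compact_setX.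
by apply: continuous_subspaceT; exact: mulg_continuous.
Qed.

End GroupTopology.

Section WordLength.
Context {G : topGroupType}.
Implicit Types (S : set G) (g h : G) (m n : nat).

Lemma setpow_mul S m n g h : setpow S m g -> setpow S n h -> setpow S (m + n) (g * h)%g.
Proof.
elim: m g => [|m IH] g /=; first by move=> ->; rewrite mul1g.
move=> [x Sx [y Sy <-]] Sh; exists x => //; exists (y * h)%g; first exact: IH.
by rewrite mulgA.
Qed.

Lemma setpow1 S g : S g -> setpow S 1 g.
Proof. by move=> Sg /=; exists g => //; exists 1%g => //; rewrite mulg1. Qed.

Lemma setpow_inv S n g : (forall x, S x -> S x^-1%g) -> setpow S n g -> setpow S n g^-1%g.
Proof.
move=> SV; elim: n g => [|n IH] g; first by move=> /= ->; rewrite invg1.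
move=> [x /SV Sx [y /IH Sy <-]]; rewrite invgM -addn1.
by apply: setpow_mul Sy _; exact: setpow1.
Qed.

Lemma setpow_compact S n : compact S -> compact (setpow S n).
Proof.
move=> cS; elim: n => [|n IH] /=; first exact: compact_set1.
exact: compact_mulg.
Qed.

Lemma setpow_length S g : generating S -> setpow S (word_length S g) g.
Proof.
move=> genS; rewrite /word_length; case: pselect => [e|[]].
  by case: ex_minnP => n /asboolP.
by have [n Sn] := genS g; exists n; apply/asboolP.
Qed.

Lemma word_length_le S g n : setpow S n g -> (word_length S g <= n)%N.
Proof.
rewrite /word_length; case: pselect => [e|//] Sn.
by case: ex_minnP => m _; apply; apply/asboolP.
Qed.

Lemma word_length_mul S g h : generating S ->
  (word_length S (g * h)%g <= word_length S g + word_length S h)%N.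
Proof.
by move=> genS; apply: word_length_le; apply: setpow_mul; exact: setpow_length.
Qed.

(** The powers of S need not increase, as S need not contain 1. *)
Definition wball S n : set G := \bigcup_(j in [set j | (j <= n)%N]) setpow S j.

Lemma wball_compact S n : compact S -> compact (wball S n).
Proof.
move=> cS; rewrite /wball; have -> : [set j | (j <= n)%N] = `I_n.+1 by apply/seteqP;
  split=> j /=; rewrite ltnS.
by rewrite bigcup_mkord; apply: bigsetU_compact => i _; exact: setpow_compact.
Qed.

Lemma wballP S n g : generating S -> wball S n g <-> (word_length S g <= n)%N.
Proof.
move=> genS; split=> [[j /= jn /word_length_le Sj]|gn]; first exact: leq_trans Sj jn.
by exists (word_length S g) => //; exact: setpow_length.
Qed.

Lemma wball1 S n : wball S n 1%g. Proof. by exists 0%N. Qed.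

Lemma wball_mul S m n g h : wball S m g -> wball S n h -> wball S (m + n) (g * h)%g.
Proof.
move=> [i /= im Si] [j /= jn Sj]; exists (i + j)%N; last exact: setpow_mul.
by rewrite /= leq_add.
Qed.

Lemma wball_sub S m n : (m <= n)%N -> wball S m `<=` wball S n.
Proof. by move=> mn g [i /= im Si]; exists i => //=; exact: leq_trans im mn. Qed.

Lemma wball_gen S g : S g -> wball S 1 g.
Proof. by move=> Sg; exists 1%N => //; exact: setpow1. Qed.

Lemma wprod_setpow (K : Type) S (t : K -> G) w :
  (forall k, S (t k)) -> setpow S (size w) (wprod t w).
Proof.
move=> St; elim: w => [|k w IH]; first by rewrite /wprod big_nil.
by rewrite wprod_cons; exists (t k) => //; exists (wprod t w).
Qed.

End WordLength.

(** * Equicontinuous families on compact sets *)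

Section Classification.
Context {R : realType} {G : topGroupType}.
Implicit Types (Fam : set (G -> R)) (S : set G).

Definition equicontinuous_on S Fam := forall h, S h -> forall eta : R, 0 < eta ->
  \forall h' \near h, forall phi, Fam phi -> `|phi h' - phi h| <= eta.

Lemma equicontinuous_onU S Fam Fam' : equicontinuous_on S Fam ->
  equicontinuous_on S Fam' -> equicontinuous_on S (Fam `|` Fam').
Proof.
move=> eF eF' h Sh eta eta0.
have := eF h Sh eta eta0; have := eF' h Sh eta eta0.
by apply: filterS2 => h' F'h Fh phi [/Fh|/F'h].
Qed.

(** The tube lemma: compactness of Q makes continuity in h uniform in x. *)
Lemma equicontinuous_on_param (X : topologicalType) (Q : set X) (F : G * X -> R) S :
  continuous F -> compact Q ->
  equicontinuous_on S [set phi | exists2 x, Q x & phi = fun h => F (h, x)].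
Proof.
move=> cF /compact_near_coveringP cQ h _ eta eta0.
have near_h : \forall h' \near h, Q `<=` (fun x => `|F (h', x) - F (h, x)| <= eta).
  apply: cQ => x Qx.
  have /cvgrPdist_lt/(_ (eta / 2))[|[A B] [/= hA xB] AB] := cF (h, x).
    by rewrite divr_gt0.
  exists (B, A) => // -[x' h'] [/= Bx' Ah'].
  have := AB (h', x') (conj Ah' Bx').
  have := AB (h, x') (conj (nbhs_singleton hA) Bx').
  rewrite /= => H1 H2; rewrite ler_norml; move: H1 H2; rewrite !ltr_norml.
  by move=> /andP[? ?] /andP[? ?]; apply/andP; split; lra.
by apply: filterS near_h => h' H _ [x Qx ->]; exact: H.
Qed.

(** Cover S by finitely many open sets on which the whole family varies by at
    most eta, and classify a point by the first of these sets that contains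
    it. *)
Lemma finite_classification S Fam (eta : R) : hausdorff_space G -> compact S -> S !=set0 ->
  equicontinuous_on S Fam -> 0 < eta ->
  exists r (c : G -> 'I_r.+1) (t : 'I_r.+1 -> G),
    [/\ forall k, measurable (c @^-1` [set k] : set (borel G)),
        forall k, S (t k)
      & forall h phi, S h -> Fam phi -> `|phi h - phi (t (c h))| <= eta].
Proof.
move=> hG cS [s0 Ss0] eqF eta0.
pose V (x : G) : set G := [set h | forall phi, Fam phi -> `|phi h - phi x| <= eta]°.
have oV x : open (V x) by exact: open_interior.
have VP x h : V x h -> forall phi, Fam phi -> `|phi h - phi x| <= eta.
  by move=> /interior_subset.
move: (cS); rewrite compact_cover => /(_ G S V (fun x _ => oV x))[|D DS SD].
  by move=> h Sh; exists h => //; exact: eqF.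
pose s := enum_fset D.
pose idx (h : G) := find (fun x => h \in V x) s.
have midx k : measurable ([set h | idx h = k] : set (borel G)).
  rewrite /idx; elim: (s) k => [|x s' IH] k /=.
    by case: k => [|k]; [rewrite (_ : [set _ | _] = setT)//; apply/seteqP|
      rewrite (_ : [set _ | _] = set0)//; apply/seteqP; split].
  case: k => [|k].
    rewrite (_ : [set _ | _] = V x).
      by apply: open_borel_measurable; exact: oV.
    apply/seteqP; split=> h /=; case: ifPn => //.
      by move=> /set_mem.
    by move=> /negP + Vh; rewrite inE.
  rewrite (_ : [set _ | _] = ~` V x `&` [set h | find (fun x0 => h \in V x0) s' = k]).
    apply: measurableI; last exact: IH.
    by apply: measurableC; apply: open_borel_measurable; exact: oV.
  apply/seteqP; split=> h /=; case: ifPn => //.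
  - by move=> /negP hV [fk]; split=> // Vh; apply: hV; rewrite inE.
  - by move=> /set_mem Vh [].
  - by move=> _ [_ ->].
have s_gt0 : (0 < size s)%N.
  have [x /= xD Vx] := SD _ Ss0.
  by rewrite lt0n size_eq0; apply/eqP => s_nil; move: xD; rewrite /= -[_ \in _]/(x \in s)
    s_nil.
exists (size s).-1, (fun h => inord (idx h)), (fun k => nth s0 s k); split.
- move=> k; rewrite (_ : _ @^-1` _ = \bigcup_(i in [set i : nat | inord i = k]) [set h |
  idx h = i]).
    by apply: bigcup_measurable => i _; exact: midx.
  by apply/seteqP; split=> [h hk|h [i /= ik hi]]; [exists (idx h)|rewrite /= hi].
- move=> k; have : nth s0 s k \in s.
    by apply: mem_nth; rewrite -[X in (_ < X)%N](prednK s_gt0).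
  by move=> kD; have := DS _ kD; rewrite inE.
- move=> h phi Sh Fphi; apply: VP => //.
  have [x /= xD Vx] := SD _ Sh.
  have hs : has (fun x => h \in V x) s by apply/hasP; exists x => //; rewrite inE.
  rewrite inordK; last by rewrite prednK// -has_find.
  by have := nth_find s0 hs; rewrite inE.
Qed.

End Classification.

(** * Haar measure of slightly translated sets *)

Section HaarMeasure.
Context {R : realType} {G : topGroupType}.
Variable m : {measure set (borel G) -> \bar R}.
Hypotheses (hG : hausdorff_space G) (haar_m : left_haar m).
Local Open Scope ereal_scope.

Lemma haar_preimage (g : G) (A : set G) : measurable (A : set (borel G)) ->
  m ((fun x => (g * x)%g) @^-1` A) = m A.
Proof.
move=> mA; have [inv _ _ _ _] := haar_m; rewrite -(inv g^-1%g A mA); congr (m _).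
apply/seteqP; split=> [x Ax|_ [x Ax <-]] /=; last by rewrite mulVKg.
by exists (g * x)%g => //; rewrite mulKg.
Qed.

Lemma measurable_translate (g : G) (A : set G) : measurable (A : set (borel G)) ->
  measurable ((fun x => (g * x)%g) @^-1` A : set (borel G)).
Proof. by apply: continuous_borel_preimage; exact: mulgl_cont. Qed.

Lemma haar_outer (A : set G) (eps : R) : measurable (A : set (borel G)) ->
  m A < +oo -> (0 < eps)%R ->
  exists2 W : set G, open W /\ A `<=` W & m W < +oo /\ m (W `\` A) <= eps%:E.
Proof.
move=> mA Afin eps0; have [_ _ _ outer _] := haar_m.
have finA : m A \is a fin_num by rewrite ge0_fin_numE.
have := finA; rewrite {1}(outer A mA) => /(lb_ereal_inf_adherent eps0).
rewrite -(outer A mA) => -[_ [W [oW AW] <-] Oeps].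
have mO := open_borel_measurable oW.
have Ofin : m W < +oo by apply: (lt_trans Oeps); apply: lte_add_pinfty => //; exact: ltry.
exists W => //; split=> //; rewrite measureD//.
rewrite setIC setIidl//.
by rewrite leeBlDl//; exact: ltW.
Qed.

Lemma haar_inner (W : set G) (eps : R) : open W -> m W < +oo -> (0 < eps)%R ->
  exists2 K : set G, compact K /\ K `<=` W & m (W `\` K) <= eps%:E.
Proof.
move=> oW Ofin eps0; have [_ _ _ _ inner] := haar_m.
have finO : m W \is a fin_num by rewrite ge0_fin_numE.
have := finO; rewrite {1}(inner W oW) => /(ub_ereal_sup_adherent eps0).
rewrite -(inner W oW) => -[_ [K [cK KO] <-] Keps].
have mO := open_borel_measurable oW.
have mK := compact_borel_measurable hG cK.
exists K => //; rewrite measureD// setIC setIidl//.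
have finK : m K \is a fin_num.
  by rewrite ge0_fin_numE// (le_lt_trans _ Ofin)// le_measure ?inE.
rewrite leeBlDr// -leeBlDl//; exact: ltW.
Qed.

(** Squeeze A inside an open W of nearly the same measure, and approximate W
    from inside by a compact K.  For u near 1 the translate of K stays in W, so
    the part of the translate of A that leaves A lies in W minus A, or comes
    from W minus K. *)
Lemma haar_translate_small (A : set G) (eps : R) : measurable (A : set (borel G)) ->
  m A < +oo -> (0 < eps)%R ->
  \forall u \near (1%g : G),
    m ((fun x => (u^-1 * x)%g) @^-1` A `\` A) <= eps%:E.
Proof.
move=> mA Afin eps0; have eps20 : (0 < eps / 2)%R by rewrite divr_gt0.
have [W [oW AW] [Ofin OA]] := haar_outer mA Afin eps20.
have [K [cK KO] OK] := haar_inner oW Ofin eps20.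
have mO := open_borel_measurable oW.
have mK := compact_borel_measurable hG cK.
have near_K : \forall u \near (1%g : G), K `<=` (fun x => W (u * x)%g).
  move/compact_near_coveringP : cK; apply => x Kx.
  have /(_ W) := @mulg_continuous G (1%g, x).
  rewrite /= mul1g => /(_ (open_nbhs_nbhs (conj oW (KO _ Kx)))).
  case=> -[A1 A2] [/= n1 n2] AW'.
  by exists (A2, A1) => // -[y u] [/= A2y A1u]; apply: (AW' (u, y)).
apply: filterS near_K => u KuO.
apply: (@le_trans _ _ (m ((fun x => (u^-1 * x)%g) @^-1` (W `\` K) `|` (W `\` A)))).
  apply: le_measure; rewrite ?inE.
  - by apply: measurableD => //; exact: measurable_translate.
  - apply: measurableU; last exact: measurableD.
    by apply: measurable_translate; exact: measurableD.
  - move=> x [/= Aux nAx]; have [Kux|nKux] := pselect (K (u^-1 * x)%g).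
      by right; split=> //; have := KuO _ Kux; rewrite mulVKg.
    by left; split=> //; exact: AW.
have mT : measurable ((fun x => (u^-1 * x)%g) @^-1` (W `\` K) : set (borel G)).
  by apply: measurable_translate; exact: measurableD.
apply: (le_trans (measureU2 m mT (measurableD mO mA))).
have mE := haar_preimage u^-1%g (measurableD mO mK).
by rewrite [eps]splitr EFinD leeD//; apply: le_trans OK; rewrite le_eqVlt; apply/orP;
  left; apply/eqP.
Qed.

End HaarMeasure.

(** * The support of the law has full measure *)

Section Support.
Context {R : realType} {G : topGroupType}.
Variables (m : {measure set (borel G) -> \bar R}) (mu : probability (borel G) R).
Hypotheses (hG : hausdorff_space G) (haar_m : left_haar m).
Hypothesis mum : mu `<< m.
Hypothesis compS : compact (msupport mu).
Hypothesis genS : generating (msupport mu).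
Local Notation S := (msupport mu).
Local Open Scope ereal_scope.

Lemma compact_off_support_null (K : set G) : compact K -> K `<=` ~` S -> mu K = 0.
Proof.
move=> cK KS.
have nullnbhd (x : G) : K x -> exists U : set G, [/\ open U, U x & mu U = 0].
  move=> /KS; rewrite /msupport /= -existsNE => -[U].
  move=> /not_implyP[oU /not_implyP[Ux U0]]; exists U; split=> //.
  by apply/eqP; rewrite -measure_le0 leNgt; apply/negP.
have /choice[V VP] : forall x : G, exists U : set G, K x -> [/\ open U, U x & mu U = 0].
  move=> x; have [Kx|nKx] := pselect (K x); last by exists set0.
  by have [U UP] := nullnbhd x Kx; exists U.
move: (cK); rewrite compact_cover => /(_ G K V)[|x Kx|D DK KD].
- by move=> x Kx; have [] := VP x Kx.
- by exists x => //; have [] := VP x Kx.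
pose F (i : nat) : set (borel G) := if (i < size (enum_fset D))%N then V (nth 1%g
  (enum_fset D) i) else set0.
have FN : forall i, mu.-negligible (F i).
  move=> i; rewrite /F; case: ifPn => [isz|_]; last exact: negligible_set0.
  have : nth 1%g (enum_fset D) i \in D by exact: mem_nth.
  move=> /DK /set_mem /VP[oV _ V0]; exists (V (nth 1%g (enum_fset D) i)); split=> //.
  exact: open_borel_measurable.
apply/(negligibleP _ (compact_borel_measurable hG cK)).
apply: negligibleS (negligible_bigcup FN) => x /KD[y /= yD Vyx].
exists (index y (enum_fset D)) => //; rewrite /F index_mem -[y \in enum_fset D]/(y \in D)
  yD.
by rewrite nth_index.
Qed.

Lemma support_closed : closed S. Proof. exact: compact_closed. Qed.

Lemma open_finite_cover (n : nat) : exists2 W : set G, open W & setpow S n `<=` W /\ m W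
  < +oo.
Proof.
have cS : compact (setpow S n) by exact: setpow_compact.
have [_ _ fin _ _] := haar_m.
have [W [oW SW] [Wfin _]] :=
  haar_outer haar_m (compact_borel_measurable hG cS) (fin _ cS) (@ltr01 R).
by exists W.
Qed.

(** For a measure on a space that is not second countable this needs
    regularity.  The group is covered by countably many open sets W of finite
    Haar measure.  The open set W minus S is, up to a Haar null set, a
    countable union of compact sets.  Each of them is null for mu, and so is the
    Haar null set. *)
Lemma support_full : mu (~` S) = 0.
Proof.
have mS : measurable (S : set (borel G)) by apply: closed_borel_measurable; exact:
  support_closed.
have oC : open (~` S) by rewrite openC; exact: support_closed.
have /choice[W WP] n : exists W : set G, [/\ open W, setpow S n `<=` W & m W < +oo].
  by have [W oW [SW fW]] := open_finite_cover n; exists W.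
apply/(negligibleP _ (measurableC mS)).
have N n : mu.-negligible (~` S `&` W n).
  have [oW _ fW] := WP n; have oCW : open (~` S `&` W n) by exact: openI.
  have mCW := open_borel_measurable oCW.
  have fCW : m (~` S `&` W n) < +oo.
    apply: le_lt_trans fW; apply: le_measure; rewrite ?inE//.
    exact: open_borel_measurable.
  have /choice[K KP] j : exists K : set G, [/\ compact K, K `<=` ~` S `&` W n &
      m ((~` S `&` W n) `\` K) <= (j.+1%:R^-1 : R)%:E].
    have [|K [cK KU] mK] := haar_inner hG haar_m oCW fCW (_ : (0 < j.+1%:R^-1 :> R)%R).
      by rewrite invr_gt0.
    by exists K.
  pose Z := \bigcap_j ((~` S `&` W n) `\` K j).
  have mK j : measurable (K j : set (borel G)).
    by have [cK _ _] := KP j; exact: compact_borel_measurable.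
  have mZ : measurable (Z : set (borel G)).
    by apply: bigcapT_measurable => j; apply: measurableD.
  have Z0 : m Z = 0.
    apply/eqP; rewrite -measure_le0; apply/lee_addgt0Pr => e e0; rewrite add0e.
    have [j je] : exists j : nat, (j.+1%:R^-1 < e)%R.
      by have /ltr_add_invr[k] := e0; rewrite add0r; exists k.
    apply: (@le_trans _ _ (m ((~` S `&` W n) `\` K j))).
      by apply: le_measure; rewrite ?inE//; [exact: measurableD|move=> x; exact].
    have [_ _ /le_trans] := KP j; apply; rewrite lee_fin; exact: ltW.
  have muZ : mu.-negligible Z.
    apply/negligibleP => //; apply/(measure0_null_setP _ mZ); apply: mum.
    exact/(measure0_null_setP _ mZ).
  have muK : mu.-negligible (\bigcup_j K j).
    apply: negligible_bigcup => j; have [cK KU _] := KP j.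
    apply/(negligibleP _ (mK j)); apply: compact_off_support_null => // x /KU[].
    by [].
  apply: negligibleS (negligibleU muZ muK) => x CWx.
  have [[j Kj]|nK] := pselect (exists j, K j x); first by right; exists j.
  by left=> j _; split=> // Kjx; apply: nK; exists j.
apply: negligibleS (negligible_bigcup N) => x Cx.
have [n Sn] := genS x; exists n => //; split=> //.
by have [_ SW _] := WP n; exact: SW.
Qed.

Lemma support_nonempty : S !=set0.
Proof.
apply/set0P/negP => /eqP S0; have := support_full; rewrite S0 setC0 => /eqP.
by rewrite probability_setT onee_eq0.
Qed.

Lemma support_inv : (forall A : set (borel G), measurable A ->
    mu ((fun x : G => x^-1%g) @^-1` A) = mu A) ->
  forall x, S x -> S x^-1%g.
Proof.
move=> sym x Sx U oU Ux; rewrite -sym; last exact: open_borel_measurable.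
by apply: Sx => //; apply: open_comp => // z _; exact: invg_continuous.
Qed.

End Support.

(** * Comparison of word lengths *)

Section Steinhaus.
Context {R : realType} {G : topGroupType}.
Variables (m : {measure set (borel G) -> \bar R}) (S : set G).
Hypotheses (hG : hausdorff_space G) (haar_m : left_haar m).
Hypotheses (compS : compact S) (genS : generating S) (S_inv : forall x, S x -> S x^-1%g).
Local Open Scope ereal_scope.

(** Steinhaus: some power A of S has positive Haar measure.  If u is close to
    1 then u A meets A, so that u lies in A A^-1, and A^-1 = A. *)
Lemma setpow_nbhs1 : exists n, \forall u \near (1%g : G), setpow S n u.
Proof.
have mS n : measurable (setpow S n : set (borel G)).
  by apply: compact_borel_measurable => //; exact: setpow_compact.
have [_ m0 fin _ _] := haar_m.
have [n Sn0] : exists n, m (setpow S n) != 0.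
  apply: contrapT => /forallNP H; move/eqP : m0; apply.
  apply/(negligibleP _ measurableT).
  have N n : m.-negligible (setpow S n).
    by apply/(negligibleP _ (mS n)); apply/eqP/negP => /negP; exact: H.
  apply: negligibleS (negligible_bigcup N) => x _.
  by have [n Sn] := genS x; exists n.
have finn : m (setpow S n) < +oo by apply: fin; exact: setpow_compact.
have finN : m (setpow S n) \is a fin_num by rewrite ge0_fin_numE.
have pos : (0 < fine (m (setpow S n)))%R by rewrite fine_gt0// finn lt0e Sn0 measure_ge0.
have pos2 : (0 < fine (m (setpow S n)) / 2)%R by rewrite divr_gt0.
exists (n + n)%N; apply: filterS (haar_translate_small hG haar_m (mS n) finn pos2) => u.
move=> small; apply: contrapT => nu.
have disj : (fun x => (u^-1 * x)%g) @^-1` setpow S n `\` setpow S n =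
    (fun x => (u^-1 * x)%g) @^-1` setpow S n.
  apply/seteqP; split=> [x []//|x /= Sux]; split=> // Sx; apply: nu.
  have -> : u = (x * (u^-1 * x)^-1)%g by rewrite invgM invgK mulgA mulgV mul1g.
  by apply: setpow_mul => //; exact: setpow_inv.
move: small; rewrite disj (haar_preimage haar_m u^-1%g (mS n)) -{1}(fineK finN) lee_fin.
lra.
Qed.

Lemma compact_sub_wball (T : set G) : compact T -> exists N, T `<=` wball S N.
Proof.
have [n nbS] := setpow_nbhs1.
move=> /compact_near_coveringP cT.
suff [N _ H] : \forall N \near \oo, T `<=` wball S N by exists N; apply: H => /=.
apply: cT => x Tx; have [k Sk] := genS x.
have near_x : \forall y \near x, setpow S (k + n) y.
  have near_xV : \forall y \near x, setpow S n (x^-1 * y)%g.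
    by apply: (@mulgl_cont G x^-1%g x); rewrite mulVg.
  by apply: filterS near_xV => y Sy; rewrite -[y](mulVKg x); exact: setpow_mul.
exists (setpow S (k + n), [set N | (k + n <= N)%N]) => /=.
  by split=> //; exact: nbhs_infty_ge.
by move=> [y N] /= [Sy kN]; exists (k + n)%N.
Qed.

Lemma word_length_comparison (T : set G) : compact T -> generating T ->
  exists N, forall g, (word_length S g <= N * word_length T g)%N.
Proof.
move=> cT genT; have [N TN] := compact_sub_wball cT; exists N => g.
have := setpow_length g genT; move: (word_length T g) => k.
elim: k g => [|k IH] g /=.
  by move=> ->; rewrite muln0; apply: word_length_le.
move=> [x /TN/(wballP N x genS) xN [y /IH yN <-]].
by rewrite mulnS (leq_trans (word_length_mul _ _ genS))// leq_add.
Qed.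
End Steinhaus.

(** * Translations of an absolutely continuous law *)

Section SimpleFunctionLevels.
Context d (T : measurableType d) (R : realType).
Local Open Scope ereal_scope.
Import HBNNSimple.

Lemma integral_nnsfun_levels (h : {nnsfun T >-> R}) :
  exists N (y : 'I_N -> R) (A : 'I_N -> set T),
  [/\ forall i, (0 <= y i)%R /\ exists x, y i = h x,
      forall i, measurable (A i), trivIset setT A
  & forall (m : {measure set T -> \bar R}) B, measurable B ->
    \int[m]_(x in B) (h x)%:E = \sum_(i < N) (y i)%:E * m (A i `&` B)].
Proof.
pose s := fset_set (range h).
pose y (i : 'I_#|` s|) := (enum_fset s)`_i.
have yh i : exists x, y i = h x.
  have : y i \in s by apply: mem_nth.
  by rewrite in_fset_set// inE => -[x _ <-]; exists x.
have y0 i : (0 <= y i)%R by have [x ->] := yh i.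
exists #|` s|, y, (fun i => h @^-1` [set y i]); split=> //.
  move=> i j _ _ [x [/= hi hj]]; apply/val_inj/eqP.
  rewrite -(nth_uniq 0%R (ltn_ord i) (ltn_ord j) (fset_uniq s)).
  by apply/eqP; rewrite -/(y i) -/(y j) -hi hj.
move=> m B mB.
transitivity (\int[m]_(x in B) \sum_(i < #|` s|) ((y i)%:E * (\1_(h @^-1` [set y i])
  x)%:E)).
  apply: eq_integral => x _; rewrite fimfunEord -sumEFin.
  by apply: eq_bigr => i _; rewrite EFinM.
rewrite ge0_integral_sum//; last 2 first.
- by move=> i; apply: measurable_funeM; apply/measurable_EFinP; exact: measurable_indic.
- by move=> i x _; rewrite mule_ge0 ?lee_fin.
apply: eq_bigr => i _; rewrite ge0_integralZl_EFin//.
  by rewrite integral_indic.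
by apply/measurable_EFinP; exact: measurable_indic.
Qed.

End SimpleFunctionLevels.

Section DensityTranslation.
Context {R : realType} {G : topGroupType}.
Variables (m : {measure set (borel G) -> \bar R}) (mu : probability (borel G) R).
Hypotheses (hG : hausdorff_space G) (haar_m : left_haar m).
Variable f : borel G -> \bar R.
Hypotheses (mf : measurable_fun setT f) (f0 : forall x, (0 <= f x)%E).
Hypothesis muf : forall A, measurable A -> mu A = (\int[m]_(x in A) f x)%E.
Local Open Scope ereal_scope.
Import HBNNSimple.

(** A simple function below the density with almost full integral.  The upper
    bound on B is the lower bound on its complement. *)
Lemma simple_minorant (delta : R) : (0 < delta)%R ->
  exists h : {nnsfun borel G >-> R}, forall B, measurable B ->
    \int[m]_(x in B) (h x)%:E <= mu B /\
    mu B <= \int[m]_(x in B) (h x)%:E + delta%:E.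
Proof.
move=> delta0.
have fin1 : \int[m]_x f x \is a fin_num by rewrite -muf// probability_setT.
have := fin1; rewrite {1}ge0_integralTE// => /(ub_ereal_sup_adherent delta0).
rewrite -ge0_integralTE// -muf// probability_setT => -[_ [h hf <-] hdelta].
exists h => B mB.
have mh D : measurable_fun D (fun x => (h x)%:E).
  by apply: measurable_funTS; apply/measurable_EFinP.
have h0 x : 0 <= (h x)%:E by rewrite lee_fin.
have le C : measurable C -> \int[m]_(x in C) (h x)%:E <= mu C.
  move=> mC; rewrite muf//; apply: ge0_le_integral => //.
  exact: measurable_funTS.
split; first exact: le.
have mCB := measurableC mB.
have split : \int[m]_(x in B) (h x)%:E + \int[m]_(x in ~` B) (h x)%:E = sintegral m h.
  rewrite -integralT_nnsfun -(setUv B) ge0_integral_setU//.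
  by apply/disj_setPS; rewrite setICr.
have muC : mu B + mu (~` B) = 1.
  by rewrite addeC probability_setC// subeK// fin_num_measure.
have leC := le _ mCB.
have finC : \int[m]_(x in ~` B) (h x)%:E \is a fin_num.
  rewrite ge0_fin_numE ?integral_ge0//; apply: le_lt_trans leC _.
  by rewrite ltey_eq fin_num_measure.
rewrite -(leeD2rE _ _ finC); apply: (@le_trans _ _ 1).
  by rewrite -muC leeD2l.
rewrite addeAC split.
by move: hdelta; rewrite lteBlDr// => /ltW.
Qed.

(** Continuity of translations in total variation.  For a simple density it
    follows from haar_translate_small on the level sets, which are finitely many
    and have finite measure where the simple function is nonzero. *)
Lemma measure_translate (delta : R) : (0 < delta)%R ->
  \forall u \near (1%g : G), forall B : set (borel G), measurable B ->
    mu ((fun x : G => (u * x)%g) @^-1` B) <= mu B + delta%:E.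
Proof.
move=> delta0; have d20 : (0 < delta / 2)%R by rewrite divr_gt0.
have [h hB] := simple_minorant d20.
have [N [y [A [yh mA _ hE]]]] := integral_nnsfun_levels h.
have y0 i : (0 <= y i)%R by have [] := yh i.
have yA i : (y i)%:E * m (A i) <= 1.
  have := (hB setT measurableT).1; rewrite hE//.
  rewrite probability_setT.
  apply: le_trans; rewrite (bigD1 i)//= setIT leeDl// sume_ge0// => j _.
  by rewrite mule_ge0 ?lee_fin.
have small i : \forall u \near (1%g : G), (y i)%:E *
    m ((fun x : G => (u^-1 * x)%g) @^-1` (A i) `\` A i) <= (delta / 2 / N.+1%:R)%:E.
  have [yi0|yi0] := eqVneq (y i) 0%R.
    by apply: nearW => u; rewrite yi0 mul0e lee_fin divr_ge0// ltW.
  have yi_gt0 : (0 < y i)%R by rewrite lt0r yi0 y0.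
  have Afin : m (A i) < +oo.
    rewrite ltey; apply/eqP => Aoo; move: (yA i); rewrite Aoo mulry gtr0_sg// mul1e.
    by rewrite leye_eq.
  have e0 : (0 < delta / 2 / N.+1%:R / y i)%R by rewrite !divr_gt0.
  apply: filterS (haar_translate_small hG haar_m (mA i) Afin e0) => u.
  move=> /(lee_wpmul2l (_ : 0 <= (y i)%:E)); rewrite lee_fin => /(_ (y0 i)) /le_trans;
    apply.
  by rewrite -EFinM mulrC divfK.
apply: filterS (filter_forall _ small) => u Hu B mB.
have muB : measurable ((fun x : G => (u * x)%g) @^-1` B : set (borel G)).
  exact: measurable_translate.
apply: (le_trans (hB _ muB).2); rewrite [delta in leRHS]splitr EFinD addeA leeD2r//.
apply: (@le_trans _ _ (\int[m]_(x in B) (h x)%:E + (delta / 2)%:E)); last first.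
  by rewrite leeD2r//; exact: (hB _ mB).1.
rewrite !hE//.
apply: (@le_trans _ _ (\sum_(i < N) ((y i)%:E * m (A i `&` B) + (delta / 2 / N.+1%:R)%:E))).
  apply: lee_sum => i _; apply: le_trans (leeD (lexx _) (Hu i)).
  rewrite -ge0_muleDr// lee_wpmul2l ?lee_fin//.
  pose TA := (fun x : G => (u^-1 * x)%g) @^-1` (A i).
  have mTA : measurable (TA : set (borel G)) by exact: measurable_translate.
  have -> : A i `&` (fun x : G => (u * x)%g) @^-1` B = (fun x : G => (u * x)%g) @^-1` (TA
    `&` B).
    by apply/seteqP; split=> x /=; rewrite /TA /= mulKg.
  rewrite haar_preimage//; last exact: measurableI.
  apply: (@le_trans _ _ (m ((A i `&` B) `|` (TA `\` A i)))).
    apply: le_measure; rewrite ?inE.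
    - exact: measurableI.
    - by apply: measurableU; [exact: measurableI|exact: measurableD].
    - by move=> x [TAx Bx]; have [?|?] := pselect (A i x); [left|right].
  by apply: measureU2; [exact: measurableI|exact: measurableD].
rewrite big_split /= leeD2l// sumEFin lee_fin sumr_const card_ord -[leLHS]mulr_natr.
move: (delta / 2)%R d20 => e e0.
by rewrite mulrAC ler_pdivrMr// ler_wpM2l ?ler_nat// ltW.
Qed.

End DensityTranslation.

(** * Uniform continuity of bounded harmonic functions *)

Lemma integral_cst_prob d (T : measurableType d) (R : realType) (mu : probability T R)
  (a : R) : (\int[mu]_(_ in setT) a%:E = a%:E)%E.
Proof.
rewrite integral_cst//; transitivity (a%:E * 1)%E; last by rewrite mule1.
by congr (_ * _)%E; exact: probability_setT.
Qed.

Section Comparison.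
Context d (T : measurableType d) (R : realType).
Variables (mu nu : probability T R) (delta : R).
Hypothesis nu_mu : forall B, measurable B -> (nu B <= mu B + delta%:E)%E.
Import HBNNSimple.

(** A simple function with values in [0, 1] gains at most the excess of nu over
    mu on the union of the levels where nu exceeds mu. *)
Lemma integral_le_perturbation (phi : T -> R) : (forall x, 0 <= phi x <= 1) ->
  (\int[nu]_x (phi x)%:E <= \int[mu]_x (phi x)%:E + delta%:E)%E.
Proof.
move=> phi01; have phi0 x : (0 <= (phi x)%:E)%E by rewrite lee_fin; have /andP[] := phi01 x.
rewrite [in leLHS]ge0_integralTE//; apply: ge_ereal_sup => _ [h hphi <-].
apply: (@le_trans _ _ (\int[mu]_x (h x)%:E + delta%:E)%E); last first.
  rewrite leeD2r// integralT_nnsfun.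
  by rewrite [leRHS]ge0_integralTE//; apply: ereal_sup_ubound; exists h.
rewrite -integralT_nnsfun.
have [N [y [A [yh mA tA hE]]]] := integral_nnsfun_levels h.
rewrite !hE//.
have fin (m : probability T R) i : m (A i `&` setT) \is a fin_num.
  by rewrite fin_num_measure// setIT.
pose a (m : probability T R) i := fine (m (A i `&` setT)).
have aE (m : probability T R) : (\sum_(i < N) (y i)%:E * m (A i `&` setT) = (\sum_(i < N)
  y i * a m i)%:E)%E.
  rewrite -sumEFin; apply: eq_bigr => i _; rewrite EFinM.
  by rewrite fineK.
rewrite !aE -EFinD lee_fin.
pose P := [pred i | a mu i < a nu i].
have key : \sum_(i < N | P i) a nu i <= \sum_(i < N | P i) a mu i + delta.
  have sumP (m : probability T R) : (\sum_(i < N | P i) a m i)%:E =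
      m (\big[setU/set0]_(i < N | P i) A i).
    rewrite measure_bigsetU_ord// -sumEFin; apply: eq_bigr => i _.
    by rewrite fineK// setIT.
  by rewrite -lee_fin EFinD !sumP; apply: nu_mu; exact: bigsetU_measurable.
apply: (@le_trans _ _ (\sum_(i < N) (y i * a mu i + (if P i then a nu i - a mu i else 0)))).
  apply: ler_sum => i _; have [yi0 [x yx]] := yh i.
  have y1 : y i <= 1.
    by rewrite yx -lee_fin (le_trans (hphi x))// lee_fin; have /andP[] := phi01 x.
  rewrite -lerBlDl -mulrBr; case: ifPn => /= [lt|]; last first.
    by rewrite -leNgt => le; rewrite mulr_ge0_le0// subr_le0.
  by rewrite ler_piMl// subr_ge0 ltW.
by rewrite big_split /= lerD2l -big_mkcond /= sumrB lerBlDl.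
Qed.

End Comparison.

Section Harmonic.
Context {R : realType} {G : topGroupType}.
Variable mu : probability (borel G) R.

Lemma continuous_bounded_integrable (f : G -> R) (M : R) : continuous f -> (forall g, `|f
  g| <= M) ->
  mu.-integrable setT (EFin \o f : borel G -> \bar R).
Proof.
move=> cf fM; apply: measurable_bounded_integrable => //.
- by rewrite (le_lt_trans (probability_le1 mu measurableT))// ltry.
- exact: continuous_borel_measurable.
- exists M; split; first exact: num_real.
  by move=> x Mx g _; apply: le_trans (fM g) (ltW Mx).
Qed.

Lemma harmonic_affine (f : G -> R) (M a c : R) (x : G) : continuous f ->
  (forall g, `|f g| <= M) -> mu_harmonic mu f ->
  mu_harmonic mu (fun g => a + c * f (x * g)%g).
Proof.
move=> cf fM harm g; rewrite /markov_op /=.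
have cfx : continuous (fun h : G => f (x * (g * h))%g).
  move=> h; apply: (@continuous_comp _ _ _ (fun h => x * (g * h))%g f); last exact: cf.
  by apply: (mulg_cont2 (@cst_cont _ _ x) (@mulgl_cont _ g)).
have int1   := continuous_bounded_integrable cfx (fun h => fM _).
have int2 : mu.-integrable setT (EFin \o (fun=> a) : borel G -> \bar R).
  exact: finite_measure_integrable_cst.
transitivity (\int[mu]_h ((a%:E : \bar R) + c%:E * (f (x * (g * h))%g)%:E))%E.
  by apply: eq_integral => h _; rewrite EFinD EFinM.
rewrite integralD//; last exact: integrableZl.
rewrite integralZl// integral_cst_prob EFinD EFinM; congr (_ + _ * _)%E.
have := harm (x * g)%g; rewrite /markov_op /= => <-.
by apply: eq_integral => h _; rewrite mulgA.
Qed.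

Lemma affine_continuous (a c : R) (f : G -> R) : continuous f ->
  continuous (fun g => a + c * f g).
Proof. by move=> cf g; apply: cvgD; [exact: cvg_cst|apply: cvgMr; exact: cf]. Qed.

(** f(zu) and f(z) are the integrals of h |-> f(z h) under the translate of mu
    by u and under mu; the affine change of f makes the integrand
    [0, 1]-valued. *)
Lemma harmonic_near_le (f : G -> R) (delta : R) (u : G) : continuous f ->
  (forall g, `|f g| <= 1) -> mu_harmonic mu f ->
  (forall B : set (borel G), measurable B ->
    (mu ((fun x : G => (u * x)%g) @^-1` B) <= mu B + delta%:E)%E) ->
  forall z, f (z * u)%g - f z <= 2 * delta.
Proof.
move=> cf f1 harm Hu z.
have mT : measurable_fun setT ((fun x : G => (u * x)%g) : borel G -> borel G).
  move=> _ B mB; rewrite setTI; exact: measurable_translate.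
pose phi (x : borel G) : R := 2^-1 + 2^-1 * f (z * x)%g.
have phi01 x : 0 <= phi x <= 1.
  by have := f1 (z * x)%g; rewrite ler_norml /phi => /andP[? ?]; apply/andP; split; lra.
have cphi : continuous (phi : G -> R).
  apply: affine_continuous; move=> h.
  by apply: (@continuous_comp _ _ _ (fun h => z * h)%g f); [exact: mulgl_cont|exact: cf].
have harmphi := harmonic_affine 2^-1 2^-1 z cf f1 harm.
have mphi : measurable_fun setT (EFin \o phi).
  by apply/measurable_EFinP; exact: continuous_borel_measurable.
have Eu : (\int[mu]_h (phi (u * h)%g)%:E = (phi u)%:E)%E := harmphi u.
have E1 : (\int[mu]_h (phi h)%:E = (phi 1%g)%:E)%E.
  by rewrite -(harmphi 1%g); apply: eq_integral => h _; rewrite /= mul1g.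
pose nu : probability (borel G) R := distribution mu (HB.pack ((fun x : G => (u * x)%g) :
  borel G -> borel G) (isMeasurableFun.Build _ _ _ _ _ mT)).
have nuE : (\int[nu]_h (phi h)%:E = (phi u)%:E)%E.
  rewrite -Eu [LHS](ge0_integral_pushforward mT)//.
  by move=> y _; rewrite lee_fin; have /andP[] := phi01 y.
have := @integral_le_perturbation _ _ _ mu nu delta Hu phi phi01.
by rewrite nuE E1 -EFinD lee_fin /phi mulg1; lra.
Qed.

(** The lower bound is harmonic_near_le for the opposite function. *)
Lemma harmonic_right_uniform (f : G -> R) (delta : R) : continuous f ->
  (forall g, `|f g| <= 1) -> mu_harmonic mu f -> 0 < delta ->
  (forall delta, 0 < delta -> \forall u \near (1%g : G), forall B : set (borel G),
    measurable B ->
    (mu ((fun x : G => (u * x)%g) @^-1` B) <= mu B + delta%:E)%E) ->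
  \forall u \near (1%g : G), forall z, `|f (z * u)%g - f z| <= delta.
Proof.
move=> cf f1 harm delta0 trans.
have d20 : 0 < delta / 2 by rewrite divr_gt0.
apply: filterS (trans _ d20) => u Hu z.
have le1 := harmonic_near_le cf f1 harm Hu z.
have cNf : continuous (fun g => 0 + -1 * f (1 * g)%g).
  apply: affine_continuous => h.
  by apply: (@continuous_comp _ _ _ (fun h => 1 * h)%g f); [exact: mulgl_cont|exact: cf].
have N1 g : `|0 + -1 * f (1 * g)%g| <= 1 by rewrite add0r mulN1r normrN mul1g.
have := harmonic_near_le cNf N1 (harmonic_affine 0 (-1) 1%g cf f1 harm) Hu z.
rewrite !mul1g; move: le1 => le1 le2; rewrite ler_norml; apply/andP; split; lra.
Qed.

End Harmonic.

(** * Discretization of convolution powers *)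

Lemma iter_markov_ge0 {R : realType} {G : topGroupType} (mu : probability (borel G) R)
  n (f : G -> \bar R) : (forall g, (0 <= f g)%E) -> forall g, (0 <= iter n (markov_op mu)
    f g)%E.
Proof.
by move=> f0; elim: n => [//|n IH] g; rewrite iterS; apply: integral_ge0 => h _; exact: IH.
Qed.

Section Discretization.
Context {R : realType} {G : topGroupType}.
Variables (mu : probability (borel G) R) (S : set G).
Hypotheses (mS : measurable (S : set (borel G))) (S1 : mu (~` S) = 0%E).
Variables (phi : G -> R) (N : nat) (eta : R).
Hypotheses (phi0 : forall g, 0 <= phi g).

Section Lower.
Context {K : finType}.
Variables (c : G -> K) (t : K -> G).
Hypothesis mc : forall k, measurable (c @^-1` [set k] : set (borel G)).
Hypothesis osc : forall h x y, S h -> wball S N x -> wball S N y ->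
  `|phi (x * h * y)%g - phi (x * t (c h) * y)%g| <= eta.
Hypothesis St : forall k, S (t k).
Local Notation p := (class_mass mu c).

(** One letter is classified at a time; each costs eta. *)
Lemma wexp_le_iter_markov l j x : (j + l <= N)%N -> wball S j x ->
  ((wexp p l (fun w => phi (x * wprod t w)%g) - l%:R * eta)%:E
    <= iter l (markov_op mu) (EFin \o phi) x)%E.
Proof.
elim: l j x => [|l IH] j x jlN Bx.
  by rewrite mul0r subr0 /= /wprod big_nil mulg1.
rewrite iterS /markov_op.
have xN : wball S N x by apply: wball_sub Bx; apply: leq_trans jlN; rewrite leq_addr.
pose v k := wexp p l (fun w => phi (x * t k * wprod t w)%g) - l.+1%:R * eta.
apply: (@le_trans _ _ (\sum_k p k * v k)%:E); last first.
  apply: (integral_ge_class mc mS S1).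
    by move=> h; apply: iter_markov_ge0 => g; rewrite lee_fin.
  move=> h Sh; have Bxh : wball S j.+1 (x * h)%g.
    by rewrite -addn1; apply: wball_mul Bx _; exact: wball_gen.
  have := IH _ _ (_ : j.+1 + l <= N)%N Bxh; rewrite addSnnS => /(_ jlN); apply: le_trans.
  rewrite lee_fin /v -natr1 mulrDl mul1r opprD addrA [leLHS]addrAC lerD2r.
  rewrite lerBlDr -(@wexp_cst _ _ p (class_mass_sum1 mu mc) l eta) -wexpD.
  apply: le_wexp => [k|w sw]; first exact: class_mass_ge0.
  have wN : wball S N (wprod t w).
    exists l; last by rewrite -sw; exact: wprod_setpow.
    by apply: leq_trans jlN; rewrite addnS ltnW// ltnS leq_addl.
  have := osc Sh xN wN; rewrite ler_norml => /andP[H _]; move: H; lra.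
rewrite lee_fin /v; under [leRHS]eq_bigr do rewrite mulrBr.
rewrite sumrB -big_distrl /= (class_mass_sum1 mu mc) mul1r lerD2r /=.
apply: ler_sum => k _; rewrite ler_wpM2l ?class_mass_ge0//.
by under eq_wexp do rewrite wprod_cons mulgA.
Qed.

End Lower.

Section Upper.
Context {K : finType}.
Variables (p : K -> R) (t : K -> G).
Hypotheses (p_ge0 : forall k, 0 <= p k) (p_sum1 : \sum_k p k = 1).
Hypothesis eta0 : 0 <= eta.
Hypothesis step : forall l x a (g : G -> \bar R), (l <= N)%N -> wball S N x -> 0 <= a ->
  (forall h, 0 <= g h)%E ->
  (forall h, S h -> (g h <= (wexp p l (fun w => phi (x * h * wprod t w)%g) + a)%:E)%E) ->
  (\int[mu]_h g h <= (\sum_k p k * wexp p l (fun w => phi (x * t k * wprod t w)%g) + a +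
    eta)%:E)%E.

(** The hypothesis on single integrals is left abstract, because the law p on
    the letters used below is not the law of the classes but a symmetrization
    of it. *)
Lemma iter_markov_le_wexp l j x : (j + l <= N)%N -> wball S j x ->
  (iter l (markov_op mu) (EFin \o phi) x <=
    (wexp p l (fun w => phi (x * wprod t w)%g) + l%:R * eta)%:E)%E.
Proof.
elim: l j x => [|l IH] j x jlN Bx.
  by rewrite mul0r addr0 /= /wprod big_nil mulg1.
rewrite iterS /markov_op.
have xN : wball S N x by apply: wball_sub Bx; apply: leq_trans jlN; rewrite leq_addr.
apply: (le_trans (step (l := l) (x := x) (a := l%:R * eta) _ xN _ _ _)).
- by apply: leq_trans jlN; rewrite addnS ltnW// ltnS leq_addl.
- by rewrite mulr_ge0.
- by move=> h; apply: iter_markov_ge0 => g; rewrite lee_fin.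
- move=> h Sh; apply: (IH j.+1); first by rewrite addSnnS.
  by rewrite -addn1; apply: wball_mul Bx _; exact: wball_gen.
- rewrite lee_fin -natr1 mulrDl mul1r addrA !lerD2r /=.
  apply: ler_sum => k _; rewrite ler_wpM2l//.
  by under [leRHS]eq_wexp do rewrite wprod_cons mulgA.
Qed.
End Upper.
End Discretization.

Section SymmetricDiscretization.
Context {R : realType} {G : topGroupType}.
Variable mu : probability (borel G) R.
Local Notation S := (msupport mu).
Hypothesis hG : hausdorff_space G.
Hypotheses (compS : compact S) (S1 : mu (~` S) = 0%E) (Sne : S !=set0).
Hypothesis mu_sym : forall A : set (borel G), measurable A ->
    mu ((fun x : G => x^-1%g) @^-1` A) = mu A.

Let S_inv x : S x -> S x^-1%g. Proof. exact: support_inv mu_sym x. Qed.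
Let mS : measurable (S : set (borel G)). Proof. exact: compact_borel_measurable. Qed.

(** The classes of a classification have no reason to be symmetric.  The
    letters are the class representatives and their inverses with equal weights.
    A step h is approximated both by the representative of its class and by the
    inverse of the representative of the class of h^-1.  Averaging the two
    approximations gives the symmetric law, since h^-1 is distributed as h. *)
Lemma symmetric_discretization (phi : G -> R) (n : nat) (eta : R) :
  continuous phi -> (forall g, 0 <= phi g) -> 0 < eta ->
  exists (K : finType) (p : K -> R) (t : K -> G) (iv : K -> K),
   [/\ forall k, 0 <= p k, \sum_k p k = 1, forall k, S (t k),
     [/\ injective iv, forall k, p (iv k) = p k & forall k, t (iv k) = (t k)^-1%g] &
     (convolution_integral mu n (EFin \o phi) <=
       (wexp p n (fun w => phi (wprod t w)) + n%:R * eta)%:E)%E].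
Proof.
move=> cphi phi0 eta0.
pose F (sg : bool) (z : G * (G * G)) := phi (z.2.1 * (if sg then z.1 else z.1^-1) *
  z.2.2)%g.
have cF sg : continuous (F sg).
  case: sg => z; first exact: sandwich_continuous.
  have cV : (fun y : G * (G * G) => (y.1^-1%g, y.2)) @ z --> (z.1^-1%g, z.2).
    exact: (cvg_pair (@invg_cont G _ _ (@fst_cont G (G * G)%type) z) (@snd_cont G (G *
      G)%type z)).
  apply: (@continuous_comp _ _ _ (fun y : G * (G * G) => (y.1^-1%g, y.2))
    (fun z => phi (z.2.1 * z.1 * z.2.2)%g) z cV); exact: sandwich_continuous.
have cB : compact (wball S n `*` wball S n) by apply: compact_setX; exact: wball_compact.
have [r [c [t [mc St osc]]]] := finite_classification hG compS Sne
  (equicontinuous_onU (equicontinuous_on_param (S := S) (cF true) cB)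
     (equicontinuous_on_param (S := S) (cF false) cB)) eta0.
have oscT h x y : S h -> wball S n x -> wball S n y ->
    `|phi (x * h * y)%g - phi (x * t (c h) * y)%g| <= eta.
  move=> Sh Bx By; apply: (osc h (fun h => F true (h, (x, y))) Sh).
  by left; exists (x, y).
have oscF h x y : S h -> wball S n x -> wball S n y ->
    `|phi (x * h * y)%g - phi (x * (t (c h^-1))^-1 * y)%g| <= eta.
  move=> Sh Bx By; rewrite -{1}[h]invgK.
  apply: (osc h^-1%g (fun h => F false (h, (x, y))) (S_inv Sh)).
  by right; exists (x, y).
pose mass := class_mass mu c.
pose p (k : 'I_r.+1 * bool) := mass k.1 / 2.
pose t' (k : 'I_r.+1 * bool) := if k.2 then t k.1 else (t k.1)^-1%g.
have sum2 (u : 'I_r.+1 * bool -> R) : \sum_k u k = \sum_i (u (i, true) + u (i, false)).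
  transitivity (\sum_i \sum_b u (i, b)); last by apply: eq_bigr => i _; rewrite big_bool.
  by rewrite pair_bigA; apply: eq_bigr => -[].
exists ('I_r.+1 * bool)%type, p, t', (fun k => (k.1, ~~ k.2)).
have p0 k : 0 <= p k by rewrite divr_ge0// class_mass_ge0.
have psum : \sum_k p k = 1.
  rewrite -[RHS](class_mass_sum1 mu mc) sum2 /p /=; apply: eq_bigr => i _.
  by rewrite [RHS]splitr.
have St' k : S (t' k) by rewrite /t'; case: ifP => _; [|apply: S_inv]; exact: St.
split=> //.
  split=> //.
  - by move=> [i b] [j b'] /= [-> /negb_inj ->].
  - by move=> [i []]; rewrite /t' //= invgK.
rewrite /convolution_integral; under eq_wexp do rewrite -[wprod _ _]mul1g.
apply: (@iter_markov_le_wexp _ _ _ _ _ n _ phi0 _ _ _ p0 (ltW eta0) _ _ 0%N) => //; last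
  exact: wball1.
move=> l x a g ln Bx a0 g0 gu.
(* The joint class of a step and of its inverse. *)
pose c' (h : G) := (c h, c h^-1%g).
pose U (y : G) := wexp p l (fun w => phi (x * y * wprod t' w)%g).
have mcV j : measurable ((fun h : G => c h^-1%g) @^-1` [set j] : set (borel G)).
  apply: (@continuous_borel_preimage G (fun h => h^-1)%g (c @^-1` [set j])) => //.
  exact: invg_continuous.
have mc' k : measurable (c' @^-1` [set k] : set (borel G)).
  rewrite (_ : _ @^-1` _ = c @^-1` [set k.1] `&` (fun h => c h^-1%g) @^-1` [set k.2]).
    by apply: measurableI.
  by case: k => i j; apply/seteqP; split=> h => [[ci cj]|[/= ci cj]];
     [split|rewrite /c' /= ci cj].
have U0 y : 0 <= U y.
  by rewrite -(wexp0 p l); apply: le_wexp.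
pose v (k : 'I_r.+1 * 'I_r.+1) := (U (t k.1) + U (t k.2)^-1%g) / 2 + a + eta.
have Uosc y y' : (forall x' y'', wball S n x' -> wball S n y'' ->
    `|phi (x' * y * y'')%g - phi (x' * y' * y'')%g| <= eta) -> U y <= U y' + eta.
  move=> H; rewrite -(@wexp_cst _ _ p psum l eta) -wexpD.
  apply: le_wexp => // w sw.
  have wN : wball S n (wprod t' w) by exists l => //; rewrite -sw; exact: wprod_setpow.
  have := H _ _ Bx wN; rewrite ler_norml => /andP[_]; lra.
apply: (le_trans (integral_le_class mc' mS S1 (v := v) g0 _ _)).
- by move=> k; rewrite /v addr_ge0 ?(ltW eta0)// addr_ge0// divr_ge0// addr_ge0.
- move=> h Sh; apply: (le_trans (gu h Sh)); rewrite lee_fin /v /c' /=.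
  have := Uosc _ _ (fun x' y'' => @oscT h x' y'' Sh).
  have := Uosc _ _ (fun x' y'' => @oscF h x' y'' Sh).
  rewrite -/(U h); lra.
have mass2 : \sum_k class_mass mu c' k * v k =
    (\sum_i mass i * U (t i) + \sum_i mass i * U (t i)^-1%g) / 2 + a + eta.
  under eq_bigr do rewrite /v !mulrDr mulrA mulrDr mulrDl.
  rewrite !big_split /= -!big_distrl /= (class_mass_sum1 mu mc') !mul1r -mulrDl.
  congr (_ / 2 + _ + _); congr (_ + _); apply: EFin_inj.
    rewrite -(integral_class mu mc' (v := fun k => U (t k.1)))//.
    by rewrite -(integral_class mu mc (v := fun k => U (t k))).
  rewrite -(integral_class mu mc' (v := fun k => U (t k.2)^-1%g))//=.
  rewrite (integral_class mu mcV (v := fun j => U (t j)^-1%g))//.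
  congr EFin; apply: eq_bigr => j _; congr (_ * _); congr fine.
  exact: (mu_sym (mc j)).
rewrite lee_fin mass2 !lerD2r /= sum2 /p /t' /= big_split /= mulrDl !big_distrl /= lerD//.
  by apply: ler_sum => i _; rewrite mulrAC.
by apply: ler_sum => i _; rewrite mulrAC.
Qed.
End SymmetricDiscretization.

(** * A continuous majorant of the word length with small growth *)

Lemma norm_powR_continuous {R : realType} {E : normedModType R} (q : R) : 1 <= q ->
  continuous (fun x : E => `|x| `^ q).
Proof.
move=> q1 x; have q0 : 0 < q by exact: lt_le_trans q1.
have [x0|x0] := eqVneq x 0.
  apply/cvgrPdist_lt => e e0; rewrite x0 normr0 powR0 ?gt_eqF//.
  have m0 : 0 < Num.min e 1 by rewrite lt_min e0 ltr01.
  have : \forall y \near (0 : E), `|y| < Num.min e 1 by exact: nbhs0_lt.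
  apply: filterS => y; rewrite sub0r normrN lt_min => /andP[ye y1].
  rewrite ger0_norm ?powR_ge0//; apply: le_lt_trans ye.
  have [->|y0] := eqVneq `|y| 0; first by rewrite powR0 ?gt_eqF.
  by rewrite ge1r_powR// lt_neqAle eq_sym y0 normr_ge0 ltW.
have nx0 : 0 < `|x| by rewrite normr_gt0.
have cE : (fun y : E => expR (q * ln `|y|)) @ x --> expR (q * ln `|x|).
  apply: (@continuous_comp _ _ _ (fun y : E => q * ln `|y|) expR); last exact:
    continuous_expR.
  apply: cvgMr; apply: (@continuous_comp _ _ _ (fun y : E => `|y|) (@ln R)).
    exact: norm_continuous.
  exact: continuous_ln.
have E0 : \forall y \near x, 0 < `|y|.
  by apply: (cvgr_gt `|x|) => //; exact: norm_continuous.
rewrite /continuous_at /=; have -> : `|x| `^ q = expR (q * ln `|x|) by rewrite /powR gt_eqF.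
apply: cvg_trans cE; apply: near_eq_cvg; apply: filterS E0 => y y0.
by rewrite /powR gt_eqF.
Qed.

(** The case t = 1/2 of uniform smoothness, centred at the barycentre. *)
Lemma midpoint_smooth {R : realType} {E : completeNormedModType R} (q : R) :
  uniformly_smooth E q -> exists2 D : R, 0 < D & forall u w : E,
  `|u + w| `^ q + `|u - w| `^ q <= 2 * `|u| `^ q + D / 2 * (2 * `|w|) `^ q.
Proof.
move=> [D [D0 H]]; exists D => // u w.
have := H (- w) w u 2^-1; rewrite invr_ge0 ler0n invf_le1//.
have -> : 1 - 2^-1 = 2^-1 :> R by field.
rewrite ler1n => /(_ isT); rewrite opprK scalerN addNr subr0.
have -> : `|- w - w| = 2 * `|w|.
  by rewrite -opprD normrN -mulr2n normrMn mulr_natl.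
by move=> H'; move: H'; set A := _ `^ q; set B := _ `^ q; set C := _ `^ q; set U := _ `^
  q; lra.
Qed.

Lemma iter_markov_mono {R : realType} {G : topGroupType} (mu : probability (borel G) R)
  n (f g : G -> \bar R) : (forall x, 0 <= f x)%E -> (forall x, f x <= g x)%E ->
  forall x, (iter n (markov_op mu) f x <= iter n (markov_op mu) g x)%E.
Proof.
move=> f0 fg; elim: n => [//|n IH] x; rewrite !iterS.
by apply: ge0_le_integral_nonmeasurable => h; [exact: iter_markov_ge0|exact: IH].
Qed.

(** If n^(1/q) <= d |b(g)| for all g of length n, then n <= d^q |b(g)|^q, and
    d^q = eps.  The ratio is small only for large n, whence A.  The values 0 and
    +oo of the compression are harmless: the former makes the ratio +oo, and the
    latter only occurs when there is no g of length n. *)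
Lemma compression_length_bound {R : realType} {G : topGroupType}
    {E : completeNormedModType R} (T : set G) (b : G -> E) (q eps : R) : 0 < q -> 0 < eps ->
  ((n%:R `^ q^-1)%:E / compression T b n)%E @[n --> \oo] --> 0%E ->
  exists A : R, 0 <= A /\ forall g, (word_length T g)%:R <= A + eps * `|b g| `^ q.
Proof.
move=> q0 eps0 rho_b.
pose d := eps `^ q^-1.
have d0 : 0 < d by exact: powR_gt0.
have dq : d `^ q = eps by rewrite -powRrM mulVf ?gt_eqF// powRr1// ltW.
have /fine_cvgP[fin /cvgr0Pnorm_lt/(_ d d0) near_d] := rho_b.
have [N _ HN] := filterI fin near_d.
exists N.+1%:R; split => // g; have [gN|Ng] := leqP (word_length T g) N.+1.
  by rewrite -[leLHS]addr0 lerD ?ler_nat// mulr_ge0 ?powR_ge0// ltW.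
have [finN ltd] := HN _ (ltnW (ltnW Ng) : (N <= word_length T g)%N).
set n := word_length T g in Ng finN ltd *.
have le_b : (compression T b n <= `|b g|%:E)%E by apply: ereal_inf_lbound; exists g.
have ge0c : (0 <= compression T b n)%E.
  by apply: le_ereal_inf_tmp => _ [h _ <-]; rewrite lee_fin.
have n0 : 0 < n%:R `^ q^-1 :> R by rewrite powR_gt0// ltr0n (leq_trans _ Ng).
have {}ltd : `|fine ((n%:R `^ q^-1)%:E / compression T b n)%E| < d := ltd.
have {}finN : ((n%:R `^ q^-1)%:E / compression T b n)%E \is a fin_num := finN.
move: finN ltd le_b ge0c; case: (compression T b n) => [r| |] //.
have [->|r0] := eqVneq r 0; first by rewrite inve0 mulry gtr0_sg// mul1e.
rewrite inver (negbTE r0) !lee_fin /= => _ ltd rb r_ge0; move: ltd.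
have {r0 r_ge0}r0 : 0 < r by rewrite lt0r r0.
move=> /(le_lt_trans (ler_norm _)); rewrite ltr_pdivrMr// => nd.
have : n%:R `^ q^-1 <= d * `|b g| by apply: ltW; apply: lt_le_trans nd _; rewrite
  ler_wpM2l// ltW.
move=> /(ge0_ler_powR (ltW q0)); rewrite !nnegrE powR_ge0 mulr_ge0 ?(ltW d0)// => /(_ isT
  isT).
rewrite -powRrM mulVf ?gt_eqF// powRr1// powRM ?(ltW d0)// dq => /le_trans; apply.
by rewrite lerDr.
Qed.

Lemma compact_norm_bound {R : realType} {T : topologicalType} {E : normedModType R}
  (f : T -> E) (S : set T) : continuous f -> compact S ->
  exists B : R, 0 <= B /\ forall x, S x -> `|f x| <= B.
Proof.
move=> cf cS; have cfS : compact (f @` S).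
  by apply: continuous_compact => //; exact: continuous_subspaceT.
have [M [_ HM]] := compact_bounded cfS.
exists (Num.max 0 (M + 1)); split; first by rewrite le_max lexx.
move=> x Sx; apply: (HM (Num.max 0 (M + 1))); last by exists x.
by rewrite lt_max; apply/orP; right; rewrite ltrDl.
Qed.

Section SpeedMajorant.
Context {R : realType} {G : topGroupType} {E : completeNormedModType R}.
Variable mu : probability (borel G) R.
Local Notation S := (msupport mu).
Hypothesis hG : hausdorff_space G.
Hypotheses (compS : compact S) (S1 : mu (~` S) = 0%E) (Sne : S !=set0).
Hypothesis mu_sym : forall A : set (borel G), measurable A ->
    mu ((fun x : G => x^-1%g) @^-1` A) = mu A.
Variables (q : R) (pi : G -> {linear E -> E}) (b : G -> E).
Hypothesis q1 : 1 <= q.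
Hypothesis smoothE : uniformly_smooth E q.
Hypotheses (rep_pi : continuous_isometric_rep pi) (cocycle_b : cocycle pi b).

(** The affine function of |b|^q is discretized as a whole: linearity is only
    used for finite sums. *)
Lemma cocycle_moment : exists2 C : R, 0 <= C & forall (A eps : R) (n : nat), 0 <= A -> 0
  <= eps ->
  (convolution_integral mu n (EFin \o (fun g : G => (A + eps * `|b g| `^ q)%R)) <=
    (A + 1 + eps * (C * n.+1%:R))%:E)%E.
Proof.
have [D D0 mid] := midpoint_smooth smoothE.
have cb : continuous b by case: cocycle_b.
have [B [B0 bB]] := compact_norm_bound cb compS.
pose Q := D / 4 * (4 * B) `^ q.
have Q0 : 0 <= Q by rewrite mulr_ge0 ?powR_ge0// divr_ge0 ?ltW.
have Bq0 : 0 <= B `^ q by exact: powR_ge0.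
exists (4 `^ q * (Q + B `^ q)); first by rewrite mulr_ge0 ?powR_ge0// addr_ge0.
move=> A eps n A0 eps0; pose phi (g : G) : R := A + eps * `|b g| `^ q.
have phi0 g : 0 <= phi g by rewrite addr_ge0// mulr_ge0// powR_ge0.
have cphi : continuous phi.
  apply: affine_continuous => g.
  by apply: (@continuous_comp _ _ _ b (fun x : E => `|x| `^ q)); [exact: cb|exact:
    norm_powR_continuous].
have e0 : 0 < n.+1%:R^-1 :> R by rewrite invr_gt0.
have [K [p [t [iv [p0 psum St [iv_inj p_iv t_iv] le_conv]]]]] :=
  symmetric_discretization hG compS S1 Sne mu_sym n cphi phi0 e0.
apply: (le_trans le_conv); rewrite lee_fin /phi wexpD wexp_cst// wexpZ [leRHS]addrAC
  lerD//; last first.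
  by rewrite ler_pdivrMr// mul1r ler_nat.
rewrite lerD2l ler_wpM2l//.
have := markov_type rep_pi cocycle_b q1 D0 mid p0 psum iv_inj p_iv t_iv (fun k => bB _
  (St k)) n.
move=> /le_trans; apply; rewrite -/Q -[leRHS]mulrA ler_wpM2l ?powR_ge0// mulrDl.
rewrite lerD//.
  by rewrite mulrC ler_wpM2l// ler_nat.
by rewrite ler_peMr// ler1n.
Qed.

Variable m : {measure set (borel G) -> \bar R}.
Hypothesis haar_m : left_haar m.
Hypothesis genS : generating S.
Variable T : set G.
Hypotheses (compT : compact T) (genT : generating T).
Hypothesis rho_b : ((n%:R `^ q^-1)%:E / compression T b n)%E @[n --> \oo] --> 0%E.

(** The cocycle enters the drift and the Liouville property only through this
    statement. *)
Lemma speed_majorant (eps : R) : 0 < eps ->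
  exists (phi : G -> R) (A : R), [/\ continuous phi,
    forall g, (word_length S g)%:R <= phi g, 0 <= A &
    forall n, (convolution_integral mu n (EFin \o phi) <= (A + eps * n%:R)%:E)%E].
Proof.
move=> eps0; have [C C0 HC] := cocycle_moment.
have [N HN] := word_length_comparison hG haar_m compS genS (support_inv mu_sym) compT genT.
(* N compares the two word lengths and C is the rate of the q-th moment. *)
pose e := eps / (C + 1) / N.+1%:R.
have e0 : 0 < e by rewrite !divr_gt0// ltr_wpDl.
have q0 : 0 < q by exact: lt_le_trans q1.
have [A [A0 HA]] := compression_length_bound q0 e0 rho_b.
pose phi (g : G) : R := N.+1%:R * A + (N.+1%:R * e) * `|b g| `^ q.
exists phi, (N.+1%:R * A + 1 + eps); split.
- apply: affine_continuous => g.
  apply: (@continuous_comp _ _ _ b (fun x : E => `|x| `^ q)); last exact: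
    norm_powR_continuous.
  by case: cocycle_b => cb _; exact: cb.
- move=> g; apply: (@le_trans _ _ (N.+1%:R * (word_length T g)%:R)).
    by rewrite -natrM ler_nat (leq_trans (HN g))// leq_mul2r leqnSn orbT.
  by rewrite /phi -mulrA -mulrDr ler_wpM2l ?HA.
- by rewrite addr_ge0 ?(ltW eps0)// addr_ge0// mulr_ge0.
- move=> n; apply: (le_trans (HC _ _ n _ _)); first by rewrite mulr_ge0.
    by rewrite mulr_ge0// ltW.
  have -> : N.+1%:R * A + 1 + eps + eps * n%:R = N.+1%:R * A + 1 + eps * n.+1%:R.
    by rewrite -natr1; ring.
  have -> : N.+1%:R * e = eps / (C + 1) by rewrite /e mulrC divfK.
  rewrite lee_fin lerD2l mulrA ler_wpM2r// mulrAC ler_pdivrMr ?ltr_wpDl//.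
  by rewrite ler_wpM2l ?(ltW eps0)// lerDl.
Qed.

End SpeedMajorant.

(** * Laws of classified trajectories *)

Lemma measure_bigsetU_fin_le d (T : measurableType d) (R : realType) (P : {measure set T
  -> \bar R})
  (K : finType) (F : K -> set T) : (forall k, measurable (F k)) ->
  (P (\bigcup_k F k) <= \sum_k P (F k))%E.
Proof.
move=> mF; suff H (r : seq K) : (P (\big[setU/set0]_(k <- r) F k) <= \sum_(k <- r) P (F
  k))%E.
  apply: le_trans (H (index_enum K)); apply: le_measure; rewrite ?inE.
  - by apply: fin_bigcup_measurable => //; exact: finite_finset.
  - exact: bigsetU_measurable.
  - by move=> x [k _ Fx]; rewrite -bigcup_seq; exists k => //=; rewrite mem_index_enum.
elim: r => [|k r IH]; first by rewrite !big_nil measure0.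
rewrite !big_cons; apply: (le_trans (measureU2 _ _ _)) => //; last by rewrite leeD2l.
exact: bigsetU_measurable.
Qed.

Section Cylinders.
Context {R : realType} {G : topGroupType}.
Variable mu : probability (borel G) R.
Context d (Omega : measurableType d) (P : probability Omega R).
Variable omega : nat -> Omega -> borel G.
Hypothesis iid : iid_of_law mu P omega.
Context {K : finType}.
Variables (c : G -> K).
Hypothesis mc : forall k, measurable (c @^-1` [set k] : set (borel G)).
Local Notation p := (class_mass mu c).
Local Notation seen s n x := (mkseq (fun i => c (omega (s + i)%N x)) n).

Lemma measurable_letter i k : measurable [set x | c (omega i x) = k].
Proof.
by have [mo _ _] := iid; rewrite -[X in measurable X]setTI; exact: (mo i _ _ (mc k)).
Qed.

Let seenS s n x : seen s n.+1 x = c (omega s x) :: seen s.+1 n x.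
Proof.
rewrite /mkseq /= addn0 -[1%N]addn0 iotaDl -map_comp; congr (_ :: _).
by apply: eq_map => i /=; rewrite add1n addSnnS.
Qed.

Lemma measurable_seen s n (B : pred (seq K)) : measurable [set x | B (seen s n x)].
Proof.
elim: n s B => [|n IH] s B.
  rewrite /mkseq /=; case: (B [::]).
    by rewrite (_ : [set _ | _] = setT)//; apply/seteqP; split.
  by rewrite (_ : [set _ | _] = set0)//; apply/seteqP; split.
rewrite (_ : [set _ | _] = \bigcup_k ([set x | c (omega s x) = k] `&`
    [set x | B (k :: seen s.+1 n x)])).
  apply: fin_bigcup_measurable => [|k _]; first exact: finite_finset.
  apply: measurableI; first exact: measurable_letter.
  exact: (IH s.+1 (fun w => B (k :: w))).
apply/seteqP; split=> x /=; rewrite seenS.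
  by move=> Bx; exists (c (omega s x)).
by move=> [k _ [/= -> Bx]].
Qed.

Lemma cylinder_mass (w : seq K) :
  P [set x | seen 0 (size w) x = w] = (\prod_(k <- w) p k)%:E.
Proof.
case: w => [|k0 w0].
  rewrite big_nil -[RHS](@probability_setT _ _ _ P); congr (P _).
  by apply/seteqP; split.
move: (k0 :: w0) => {w0}w; have [_ law indep] := iid.
pose J := [fset i in iota 0 (size w)]%fset.
pose A i : set (borel G) := c @^-1` [set nth k0 w i].
have -> : [set x | seen 0 (size w) x = w] = \bigcap_(i in [set` J]) (omega i @^-1` A i).
  apply/seteqP; split=> [x /= xw i /=|x xA /=].
    rewrite !inE mem_iota /= => isz.
    by have := congr1 (nth k0 ^~ i) xw; rewrite nth_mkseq.
  apply: (@eq_from_nth _ k0); rewrite size_mkseq// => i isz.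
  by rewrite nth_mkseq//; apply: xA; rewrite /= !inE mem_iota.
rewrite indep; last by move=> i; exact: mc.
rewrite (perm_big (iota 0 (size w))) /=; last first.
  apply: uniq_perm; rewrite ?iota_uniq ?fset_uniq//.
  by move=> i; rewrite !inE.
transitivity (\prod_(i <- iota 0 (size w)) (p (nth k0 w i))%:E)%E.
  by apply: eq_bigr => i _; rewrite law; [rewrite class_massE|exact: mc].
have -> : (\prod_(k <- w) p k)%:E = (\prod_(k <- w) (p k)%:E)%E.
  by elim: (w) => [|k w' IH]; rewrite ?big_nil// !big_cons EFinM IH.
by rewrite -{3}(mkseq_nth k0 w) /mkseq big_map.
Qed.

(** Union bound over the words that satisfy B, organized by the recursion that
    defines wexp: w is the part of the word that has been fixed so far. *)
Lemma seen_prob_le n (B : pred (seq K)) :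
  (P [set x | B (seen 0 n x)] <= (wexp p n (fun w => (B w)%:R))%:E)%E.
Proof.
suff H w : (P ([set x | seen 0 (size w) x == w] `&` [set x | B (w ++ seen (size w) n x)]) <=
    ((\prod_(k <- w) p k) * wexp p n (fun u => (B (w ++ u))%:R))%:E)%E.
  have := H [::]; rewrite big_nil mul1r /=; apply: le_trans.
  by rewrite le_eqVlt; apply/orP; left; apply/eqP; congr (P _); apply/seteqP; split=> x
    //= [].
elim: n w => [|n IH] w.
  rewrite [wexp _ _ _]/= cats0; have [Bw|nBw] := boolP (B w).
    rewrite mulr1 -cylinder_mass (_ : [set x | seen 0 (size w) x = w] =
      [set x | seen 0 (size w) x == w]); last by apply/seteqP; split=> x /= /eqP.
    rewrite (_ : [set _ | true] = setT) ?setIT//.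
    by apply/seteqP; split.
  rewrite (_ : [set _ | false] = set0) ?setI0 ?measure0 ?mulr0//.
  by apply/seteqP; split.
pose F k := [set x | seen 0 (size (rcons w k)) x == rcons w k] `&`
    [set x | B (rcons w k ++ seen (size (rcons w k)) n x)].
have mF k : measurable (F k).
  apply: measurableI; first exact: (measurable_seen 0 _ (pred1 (rcons w k))).
  exact: (measurable_seen (size (rcons w k)) n (fun u => B (rcons w k ++ u))).
apply: (@le_trans _ _ (P (\bigcup_k F k))).
  apply: le_measure; rewrite ?inE.
  - apply: measurableI; first exact: (measurable_seen 0 (size w) (pred1 w)).
    exact: (measurable_seen (size w) n.+1 (fun u => B (w ++ u))).
  - by apply: fin_bigcup_measurable => //; exact: finite_finset.
  - move=> x [/= /eqP sw Bx]; exists (c (omega (size w) x)) => //.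
    rewrite /F size_rcons; split=> /=.
      rewrite /mkseq -addn1 iotaD map_cat -/(mkseq _ _) sw /= add0n.
      by rewrite cats1.
    by rewrite -cats1 -catA /= -seenS.
apply: (le_trans (measure_bigsetU_fin_le _ mF)).
apply: (@le_trans _ _ (\sum_k ((\prod_(j <- rcons w k) p j) *
    wexp p n (fun u => (B (rcons w k ++ u))%:R))%:E)%E).
  by apply: lee_sum => k _; exact: IH.
rewrite sumEFin lee_fin /= big_distrr /= ler_sum// => k _.
rewrite -cats1 big_cat /= big_seq1 -mulrA.
by under eq_wexp do rewrite -catA.
Qed.
End Cylinders.

(** * A Chernoff bound for sums over blocks *)

Section Blocks.
Context {R : realType} {K : finType}.
Variables (p : K -> R) (v : seq K -> R) (k : nat).

Fixpoint bsum n (u : seq K) : R :=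
  if n is n'.+1 then v (take k u) + bsum n' (drop k u) else 0.

Lemma wexp_bsum_exp (lam : R) n :
  wexp p (n * k) (fun u => expR (lam * bsum n u)) = (wexp p k (fun w => expR (lam * v
    w))) ^+ n.
Proof.
elim: n => [|n IH]; first by rewrite mul0n /= mulr0 expR0 expr0.
rewrite mulSn wexp_cat exprS -IH mulrC -wexpZ.
apply: eq_wexp => u su; rewrite mulrC -wexpZ; apply: eq_wexp => w sw /=.
by rewrite take_size_cat// drop_size_cat// mulrDr expRD.
Qed.

Hypotheses (p_ge0 : forall j, 0 <= p j) (p_sum1 : \sum_j p j = 1).

(** At the parameter lam = 1/(2V) the exponent is at most 1/2, so the
    exponential is at most 1 + 2 lam v, whose mean is at most exp(2 lam a).  The
    threshold 3 a leaves exp(- lam a) per block. *)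
Lemma chernoff_blocks (V a : R) n : 0 < V ->
  (forall w, size w = k -> 0 <= v w <= V) -> wexp p k v <= a ->
  wexp p (n * k) (fun u => (3 * a * n%:R < bsum n u)%R%:R) <=
    expR (- (a / (2 * V))) ^+ n.
Proof.
move=> V0 vV va; pose lam := (2 * V)^-1.
have lam0 : 0 < lam by rewrite invr_gt0 mulr_gt0.
apply: (@le_trans _ _ (wexp p (n * k) (fun u => expR (- (lam * (3 * a * n%:R))) * expR
  (lam * bsum n u)))).
  apply: le_wexp => // u _; rewrite -expRD; case: ltP => [lt|_]; last exact: expR_ge0.
  by rewrite mulr1n -[leLHS]expR0 ler_expR addrC -mulrBr mulr_ge0 ?(ltW lam0)// subr_ge0
    ltW.
rewrite wexpZ wexp_bsum_exp.
have -> : expR (- (lam * (3 * a * n%:R))) = expR (- (3 * lam * a)) ^+ n.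
  by rewrite -expRM_natl; congr expR; ring.
rewrite -exprMn; apply: lerXn2r; rewrite ?nnegrE ?expR_ge0//.
  by rewrite mulr_ge0 ?expR_ge0// -(wexp0 p k); apply: le_wexp => // w _; exact: expR_ge0.
have mgf : wexp p k (fun w => expR (lam * v w)) <= expR (2 * lam * a).
  apply: (@le_trans _ _ (wexp p k (fun w => 1 + 2 * lam * v w))).
    apply: le_wexp => // w sw; have /andP[v0 vV'] := vV w sw.
    have lv0 : 0 <= lam * v w by rewrite mulr_ge0// ltW.
    have lv2 : lam * v w <= 2^-1.
      rewrite /lam invfM -mulrA ler_piMr// mulrC ler_pdivrMr// mul1r.
      exact: vV'.
    have := @expR_le_quadratic _ (lam * v w); rewrite ger0_norm// => /(_ lv2) /le_trans;
      apply.
    rewrite -addrA lerD2l.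
    have : (lam * v w) ^+ 2 <= lam * v w * 2^-1 by rewrite expr2 ler_wpM2l.
    have -> : 2 * lam * v w = 2 * (lam * v w) by rewrite mulrA.
    by move: (lam * v w) => x; lra.
  rewrite wexpD wexp_cst// wexpZ; apply: le_trans (expR_ge1Dx _); rewrite lerD2l.
  by rewrite ler_wpM2l// mulr_ge0// ltW.
apply: (le_trans (ler_wpM2l (expR_ge0 _) mgf)); rewrite -expRD ler_expR.
by rewrite /lam le_eqVlt; apply/orP; left; apply/eqP; field; rewrite gt_eqF.
Qed.

End Blocks.

Section GeometricBorelCantelli.
Context d (Omega : measurableType d) (R : realType) (P : probability Omega R).

Lemma geometric_ae_eventually (F : nat -> set Omega) (r : R) : 0 <= r < 1 ->
  (forall n, measurable (F n)) -> (forall n, (P (F n) <= (r ^+ n)%:E)%E) ->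
  {ae P, forall x, \forall n \near \oo, ~ F n x}.
Proof.
move=> /andP[r0 r1] mF PF.
have sumfin : (\sum_(n <oo) P (F n) < +oo)%E.
  apply: (@le_lt_trans _ _ ((1 - r)^-1)%:E); last exact: ltry.
  apply: lime_le; first by apply: is_cvg_nneseries => n _ _; exact: measure_ge0.
  apply: nearW => n; apply: (@le_trans _ _ (\sum_(0 <= i < n) (r ^+ i)%:E)%E).
    by apply: lee_sum => i _; exact: PF.
  rewrite sumEFin lee_fin -[leRHS]mul1r ler_pdivlMr ?subr_gt0//.
  have -> : (\sum_(0 <= i < n) r ^+ i) * (1 - r) = 1 - r ^+ n.
    elim: n => [|n IH]; first by rewrite big_geq// mul0r expr0 subrr.
    by rewrite big_nat_recr//= mulrDl IH exprSr; ring.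
  by rewrite gerBl exprn_ge0.
have L0 := lim_sup_set_cvg0 mF sumfin.
exists (lim_sup_set F); split=> //.
  by apply: bigcapT_measurable => i; apply: bigcup_measurable.
move=> x /= nx n _; apply: contrapT => H; apply: nx.
exists n => // j /= nj Fj; apply: H; exists j => //.
Qed.
End GeometricBorelCantelli.

(** * Zero drift *)

Section Drift.
Context {R : realType} {G : topGroupType}.
Variable mu : probability (borel G) R.
Local Notation S := (msupport mu).
Hypothesis hG : hausdorff_space G.
Hypotheses (compS : compact S) (S1 : mu (~` S) = 0%E) (Sne : S !=set0).
Hypothesis genS : generating S.
Hypothesis majorant : forall eps : R, 0 < eps ->
  exists (phi : G -> R) (A : R), [/\ continuous phi,
    forall g, (word_length S g)%:R <= phi g, 0 <= A &
    forall n, (convolution_integral mu n (EFin \o phi) <= (A + eps * n%:R)%:E)%E].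

Let mS : measurable (S : set (borel G)). Proof. exact: compact_borel_measurable. Qed.

Lemma eventually_small (A eps : R) : 0 < eps -> \forall n \near \oo, A <= eps * n%:R.
Proof.
move=> eps0; have [N _ HN] := nbhs_infty_ger (A / eps).
by exists N => // n /HN; rewrite ler_pdivrMr// mulrC.
Qed.

Lemma convolution_drift :
  ((n%:R^-1 : R)%:E * convolution_integral mu n (fun g => ((word_length S g)%:R)%:E))%E
    @[n --> \oo] --> 0%E.
Proof.
pose L n := convolution_integral mu n (fun g => ((word_length S g)%:R : R)%:E).
have L0 n : (0 <= L n)%E by apply: iter_markov_ge0 => g; rewrite lee_fin.
have L_le (eps : R) : 0 < eps -> exists2 A : R, 0 <= A & forall n, (L n <= (A + eps *
  n%:R)%:E)%E.
  move=> /majorant[phi [A [_ phi_ge A0 HA]]]; exists A => // n.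
  apply: le_trans (HA n); apply: iter_markov_mono => g; rewrite lee_fin//.
have finL n : L n \is a fin_num.
  have [A _ HA] := L_le 1 ltr01.
  by rewrite ge0_fin_numE//; apply: le_lt_trans (HA n) _; exact: ltry.
apply/fine_cvgP; split; first by apply: nearW => n; apply: fin_numM => //; exact: finL.
apply/cvgr0Pnorm_lt => eps eps0.
have e20 : 0 < eps / 2 / 2 by rewrite !divr_gt0.
have [A A0 HA] := L_le _ e20.
near=> n.
have n0 : 0 < n%:R :> R by rewrite ltr0n; near: n; exact: nbhs_infty_gt.
rewrite /= (_ : fine _ = n%:R^-1 * fine (L n)); last by rewrite fineM//; exact: finL.
rewrite ger0_norm ?mulr_ge0 ?fine_ge0 ?invr_ge0 ?ler0n//.
rewrite mulrC ltr_pdivrMr//.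
have An : A <= eps / 2 / 2 * n%:R by near: n; exact: (eventually_small A e20).
have : fine (L n) <= A + eps / 2 / 2 * n%:R by rewrite -lee_fin fineK.
rewrite /L; have := mulr_gt0 eps0 n0; lra.
Unshelve. all: end_near. Qed.

Lemma prod_setpow (hs : seq G) : (forall h, h \in hs -> S h) ->
  setpow S (size hs) (\prod_(h <- hs) h)%g.
Proof.
elim: hs => [|h hs IH] H; first by rewrite big_nil.
rewrite big_cons; exists h; first by apply: H; rewrite mem_head.
exists (\prod_(h <- hs) h)%g => //; apply: IH => h' h'hs.
by apply: H; rewrite inE h'hs orbT.
Qed.

Lemma prod_classified (phi : G -> R) (K : finType) (c : G -> K) (t : K -> G) N (eta : R) :
  (forall h x y, S h -> wball S N x -> wball S N y ->
    `|phi (x * h * y)%g - phi (x * t (c h) * y)%g| <= eta) ->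
  (forall k, S (t k)) ->
  forall (hs : seq G) j x, (forall h, h \in hs -> S h) -> (j + size hs <= N)%N -> wball S
    j x ->
  `|phi (x * \prod_(h <- hs) h)%g - phi (x * wprod t (map c hs))%g| <= (size hs)%:R * eta.
Proof.
move=> osc St; elim=> [|h hs IH] j x hsS jN Bx.
  by rewrite /wprod !big_nil subrr normr0 mul0r.
have Sh : S h by apply: hsS; rewrite mem_head.
have hsS' h' : h' \in hs -> S h' by move=> hin; apply: hsS; rewrite inE hin orbT.
rewrite big_cons /= wprod_cons !mulgA -natr1 mulrDl mul1r [leRHS]addrC.
rewrite -(subrK (phi (x * t (c h) * \prod_(h <- hs) h)%g) (phi (x * h * _)%g)) -addrA.
apply: (le_trans (ler_normD _ _)); apply: lerD.
  apply: osc => //.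
    by apply: wball_sub Bx; apply: leq_trans jN; rewrite leq_addr.
  exists (size hs).
    by apply: leq_trans jN; rewrite /= addnS ltnW// ltnS leq_addl.
  exact: prod_setpow.
apply: (IH j.+1) => //; first by rewrite addSnnS.
by rewrite -addn1; apply: wball_mul Bx _; exact: wball_gen.
Qed.

Section PathSpace.
Context d (Omega : measurableType d) (P : probability Omega R).
Variable omega : nat -> Omega -> borel G.
Hypothesis iid : iid_of_law mu P omega.

Lemma ae_in_support : {ae P, forall x, forall i, S (omega i x)}.
Proof.
apply: ae_foralln => i; exists (omega i @^-1` (~` S)); split.
- have [mo _ _] := iid; rewrite -[X in measurable X]setTI.
  by apply: (mo i) => //; exact: measurableC.
- have [_ law _] := iid; transitivity (mu (~` S)) => //; apply: law; exact: measurableC.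
- by move=> x.
Qed.

Lemma bsum_length (K : finType) (c : G -> K) (v : seq K -> R) k :
  (forall hs : seq G, size hs = k -> (forall h, h \in hs -> S h) ->
    (word_length S (\prod_(h <- hs) h)%g)%:R <= v (map c hs)) ->
  forall n (hs : seq G), size hs = (n * k)%N -> (forall h, h \in hs -> S h) ->
    (word_length S (\prod_(h <- hs) h)%g)%:R <= bsum v k n (map c hs).
Proof.
move=> vP; elim=> [|n IH] hs shs hsS.
  have -> : hs = [::] by apply: size0nil.
  by rewrite big_nil /= lern0 -leqn0; apply: word_length_le.
rewrite -{1}(cat_take_drop k hs) big_cat /= -map_take -map_drop.
apply: (@le_trans _ _ ((word_length S (\prod_(h <- take k hs) h)%g)%:R +
   (word_length S (\prod_(h <- drop k hs) h)%g)%:R)).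
  by rewrite -natrD ler_nat; exact: word_length_mul.
apply: lerD.
  apply: vP; first by rewrite size_takel// shs mulSn leq_addr.
  by move=> h /mem_take; exact: hsS.
apply: IH; first by rewrite size_drop shs mulSn addKn.
by move=> h /mem_drop; exact: hsS.
Qed.

Lemma walkE n x : walk omega n x = (\prod_(h <- mkseq (fun i => omega i x : G) n) h)%g.
Proof. by rewrite /walk /mkseq big_map -[in RHS](subn0 n) -/(index_iota 0 n) big_mkord. Qed.

(** Take blocks of length k.  For large k the classified majorant v of the length
    of a block has mean at most a = eta k / 8.  The Chernoff bound costs a
    factor 3, and the incomplete last block adds at most k. *)
Lemma walk_ae_le (eta : R) : 0 < eta ->
  {ae P, forall x, \forall n \near \oo, (word_length S (walk omega n x))%:R <= eta * n%:R}.
Proof.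
move=> eta0.
have e0 : 0 < eta / 16 by rewrite divr_gt0.
have [phi [A [cphi phi_ge A0 HA]]] := majorant e0.
have [k [k_gt0 Ak]] : exists k, (0 < k)%N /\ A + 2 <= eta / 16 * k%:R.
  have [N _ HN] := filterI (nbhs_infty_gt 0) (eventually_small (A + 2) e0).
  by have [] := HN N (leqnn N); exists N.
have phi0 g : 0 <= phi g by apply: le_trans (phi_ge g).
have eta'0 : 0 < k%:R^-1 :> R by rewrite invr_gt0 ltr0n.
pose F (z : G * (G * G)) := phi (z.2.1 * z.1 * z.2.2)%g.
have cF : continuous F by exact: sandwich_continuous.
have cB : compact (wball S k `*` wball S k) by apply: compact_setX; exact: wball_compact.
have [r [c [t [mc St osc]]]] := finite_classification hG compS Sne
  (equicontinuous_on_param (S := S) cF cB) eta'0.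
have oscT h x y : S h -> wball S k x -> wball S k y ->
    `|phi (x * h * y)%g - phi (x * t (c h) * y)%g| <= k%:R^-1.
  move=> Sh Bx By; apply: (osc h (fun h => F (h, (x, y))) Sh).
  by exists (x, y).
pose p := class_mass mu c.
have p0 j : 0 <= p j by exact: class_mass_ge0.
have p1 : \sum_j p j = 1 by exact: class_mass_sum1.
pose v (w : seq 'I_r.+1) : R := phi (wprod t w) + 1.
pose a := eta / 8 * k%:R.
have a0 : 0 < a by rewrite mulr_gt0 ?divr_gt0// ltr0n.
have va : wexp p k v <= a.
  have := wexp_le_iter_markov mS S1 phi0 mc oscT St (leqnn (0 + k)) (wball1 S 0).
  move=> /le_trans /(_ (HA k)); rewrite lee_fin mulfV ?pnatr_eq0 -?lt0n//.
  rewrite /v wexpD wexp_cst//; under eq_wexp do rewrite mul1g.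
  by rewrite /a; move: Ak; set W := wexp _ _ _; lra.
pose V := 1 + \sum_(w : k.-tuple 'I_r.+1) v w.
have v0 w : 0 <= v w by rewrite addr_ge0.
have V0 : 0 < V by rewrite ltr_pwDl// sumr_ge0.
have vV w : size w = k -> 0 <= v w <= V.
  move=> /eqP sw; rewrite v0 /V (bigD1 (Tuple sw))//= addrCA lerDl addr_ge0// sumr_ge0//.
have r01 : 0 <= expR (- (a / (2 * V))) < 1.
  by rewrite expR_ge0/= expR_lt1 oppr_lt0 divr_gt0// mulr_gt0.
pose bad n := [set x | 3 * a * n%:R < bsum v k n (mkseq (fun i => c (omega (0 + i)%N x))
  (n * k))].
have mbad n : measurable (bad n).
  exact: (measurable_seen iid mc 0 (n * k) (fun u => 3 * a * n%:R < bsum v k n u)).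
have Pbad n : (P (bad n) <= (expR (- (a / (2 * V))) ^+ n)%:E)%E.
  apply: (le_trans (seen_prob_le iid mc (n * k) (fun u => 3 * a * n%:R < bsum v k n u))).
  by rewrite lee_fin; exact: chernoff_blocks.
have := geometric_ae_eventually r01 mbad Pbad.
have := ae_in_support; apply: filterS2 => x Sx [N0 _ HN0].
have len_block n : ~ bad n x -> (word_length S (walk omega (n * k) x))%:R <= 3 * a * n%:R.
  move=> /negP; rewrite -leNgt; apply: le_trans.
  rewrite walkE.
  have := @bsum_length _ c v k _ n (mkseq (fun i => omega i x : G) (n * k)).
  rewrite size_mkseq -map_comp; apply => //; last first.
    by move=> h /mapP[i _ ->].
  move=> hs shs hsS; apply: (le_trans (phi_ge _)); rewrite /v -lerBlDl.
  have jk : (0 + size hs <= k)%N by rewrite add0n shs.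
  have := prod_classified oscT St hsS jk (wball1 S 0).
  rewrite !mul1g shs mulfV ?pnatr_eq0 -?lt0n// ler_norml => /andP[_].
  by lra.
have eta20 : 0 < eta / 2 by rewrite divr_gt0.
have [N1 _ HN1] := eventually_small k%:R eta20.
exists (maxn (N0 * k) N1) => // n /=; rewrite geq_max => /andP[N0n N1n].
have n1 : k%:R <= eta / 2 * n%:R := HN1 n N1n.
have N0q : (N0 <= n %/ k)%N by rewrite leq_divRL.
have len := len_block _ (HN0 _ N0q).
have walk_split : walk omega n x = (walk omega (n %/ k * k) x *
    \prod_(h <- drop (n %/ k * k) (mkseq (fun i => omega i x : G) n)) h)%g.
  rewrite !walkE -[in LHS](cat_take_drop (n %/ k * k) (mkseq _ n)) big_cat /=; congr (_ *
    _)%g.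
  congr (\prod_(h <- _) h)%g.
  by rewrite -map_take take_iota (minn_idPl (leq_trunc_div n k)).
have rest : (word_length S (\prod_(h <- drop (n %/ k * k) (mkseq (fun i => omega i x : G)
  n)) h)%g <= k)%N.
  apply: (@leq_trans (size (drop (n %/ k * k) (mkseq (fun i => omega i x : G) n)))).
    by apply: word_length_le; apply: prod_setpow => h /mem_drop /mapP[i _ ->].
  rewrite size_drop size_mkseq {1}(divn_eq n k) addKn ltnW// ltn_pmod//.
rewrite walk_split; apply: (@le_trans _ _ (3 * a * (n %/ k)%:R + k%:R)).
  apply: (@le_trans _ _ ((word_length S (walk omega (n %/ k * k) x))%:R + k%:R)).
    by rewrite -natrD ler_nat (leq_trans (word_length_mul _ _ genS))// leq_add2l.
  by rewrite lerD2r.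
have kq : k%:R * (n %/ k)%:R <= n%:R :> R by rewrite -natrM ler_nat mulnC leq_trunc_div.
have : eta * (k%:R * (n %/ k)%:R) <= eta * n%:R by rewrite ler_wpM2l// ltW.
have := mulr_ge0 (ltW eta0) (ler0n R n).
rewrite /a; move: n1 => n1.
have -> : 3 * (eta / 8 * k%:R) * (n %/ k)%:R = 3 / 8 * (eta * (k%:R * (n %/ k)%:R)) by
  field.
lra.
Qed.
End PathSpace.
End Drift.

(** * Covering balls by translates *)

(** Shrink U to a relatively compact open set.  Right multiplication by S maps
    y U into y (U S), and U S is covered by N translates of U.  So each step
    multiplies the number of translates by N. *)
Lemma translate_cover {G : topGroupType} (S : set G) (U : set G) :
  locally_compact [set: G] -> hausdorff_space G -> compact S -> nbhs (1%g : G) U ->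
  exists2 N : nat, (0 < N)%N & forall n, exists2 ys : seq G, (size ys <= N ^ n)%N &
    forall g, wball S n g -> exists2 y, y \in ys & exists2 u, U u & g = (y * u)%g.
Proof.
move=> lcG hG cS nU.
have [C nC cC] : exists2 C : set G, nbhs (1%g : G) C & compact C.
  have [V nV [cV _]] := lcG 1%g I; exists V => //.
  have nV' : \forall g \near (1%g : G), [set: G] g -> V g := nV.
  by apply: filterS nV' => g; apply.
pose W := (U `&` C)°.
have oW : open W by exact: open_interior.
have W1 : W 1%g by apply: nbhs_singleton; apply: nbhs_interior; exact: filterI.
have WUC : W `<=` U `&` C by exact: interior_subset.
have cCS : compact [set (x * y)%g | x in C & y in S `|` [set 1%g]].
  by apply: compact_mulg => //; apply: compactU => //; exact: compact_set1.
have oV (z : G) : open [set g | W (z^-1 * g)%g].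
  by apply: (@open_comp _ _ (fun g => z^-1 * g)%g) => // g _; exact: mulgl_cont.
move: (cCS); rewrite compact_cover => /(_ G setT (fun z => [set g | W (z^-1 * g)%g]) (fun
  z _ => oV z))[|D _ DC].
  by move=> g _; exists g => //=; rewrite mulVg.
exists (size (enum_fset D)).+1 => // n.
suff [ys ysN H] : exists2 ys : seq G, (size ys <= (size (enum_fset D)).+1 ^ n)%N &
    forall g, wball S n g -> exists2 y, y \in ys & exists2 u, W u & g = (y * u)%g.
  exists ys => // g /H[y yys [u Wu gE]]; exists y => //; exists u => //.
  exact: (WUC _ Wu).1.
elim: n => [|n [ys ysN IH]].
  exists [:: 1%g] => // g [j /=]; rewrite leqn0 => /eqP -> /= ->.
  by exists 1%g; rewrite ?mem_head//; exists 1%g; [|rewrite mulg1].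
exists [seq (y * z)%g | y <- ys, z <- enum_fset D].
  by rewrite size_allpairs expnSr leq_mul.
move=> g Bg.
have [g' [s [Bg' Ss gE]]] : exists g' s, [/\ wball S n g', (S `|` [set 1%g]) s & g = (g'
  * s)%g].
  have [[|j] /= jn Sg] := Bg.
    by exists g, 1%g; split; [exists 0%N|right|rewrite mulg1].
  have [g' [s [Sg' Ss gE]]] : exists g' s, [/\ setpow S j g', S s & g = (g' * s)%g].
    elim: j g Sg {jn Bg} => [|j IHj] g /= [x Sx].
      by move=> [y -> <-]; exists 1%g, x; split=> //; rewrite mul1g mulg1.
    move=> [y /IHj[g' [s [Sg' Ss ->]]] <-].
    by exists (x * g')%g, s; split=> //; [exists x => //; exists g'|rewrite mulgA].
  by exists g', s; split=> //; [exists j|left].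
have [y yys [u Uu g'E]] := IH g' Bg'.
have [z /= zD Wz] : exists2 z, z \in D & W (z^-1 * (u * s))%g.
  have [|z /= zD Wz] := DC (u * s)%g; last by exists z.
  by exists u; [exact: (WUC _ Uu).2|exists s].
exists (y * z)%g; first by apply: allpairs_f.
by exists (z^-1 * (u * s))%g => //; rewrite gE g'E -!mulgA mulVKg.
Qed.

(** * The Liouville property at zero speed *)

Section Liouville.
Context {R : realType} {G : topGroupType}.
Variable mu : probability (borel G) R.
Local Notation S := (msupport mu).
Hypotheses (hG : hausdorff_space G) (lcG : locally_compact [set: G]).
Hypotheses (compS : compact S) (S1 : mu (~` S) = 0%E) (Sne : S !=set0).
Hypothesis genS : generating S.
Hypothesis majorant : forall eps : R, 0 < eps ->
  exists (phi : G -> R) (A : R), [/\ continuous phi,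
    forall g, (word_length S g)%:R <= phi g, 0 <= A &
    forall n, (convolution_integral mu n (EFin \o phi) <= (A + eps * n%:R)%:E)%E].
Hypothesis mu_translate : forall delta : R, 0 < delta ->
  \forall u \near (1%g : G), forall B : set (borel G), measurable B ->
    (mu ((fun x : G => (u * x)%g) @^-1` B) <= mu B + delta%:E)%E.

Let mS : measurable (S : set (borel G)). Proof. exact: compact_borel_measurable. Qed.

Lemma covering_count (U : set G) (lam : R) : nbhs (1%g : G) U -> 0 < lam ->
  exists2 rho : R, 0 < rho & forall n, exists2 ys : seq G,
    (size ys)%:R <= expR (lam * n%:R) &
    forall g, (word_length S g)%:R < rho * n%:R ->
      exists2 y, y \in ys & exists2 u, U u & g = (y * u)%g.
Proof.
move=> nU lam0; have [N N0 HN] := translate_cover lcG hG compS nU.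
have lnN0 : 0 <= ln (N%:R : R) by rewrite ln_ge0// ler1n.
pose rho := lam / (ln (N%:R : R) + 1).
have rho0 : 0 < rho by rewrite divr_gt0// ltr_wpDl.
(* N^(rho n) <= exp(lam n) *)
exists rho => // n; pose j := Num.truncn (rho * n%:R).
have rn0 : 0 <= rho * n%:R by rewrite mulr_ge0// ltW.
have [ys ysN Hys] := HN j; exists ys.
  apply: (@le_trans _ _ (N%:R ^+ j)); first by rewrite -natrX ler_nat.
  rewrite -[N%:R]lnK ?posrE ?ltr0n// -expRM_natl ler_expR mulrC.
  apply: (@le_trans _ _ (ln (N%:R : R) * (rho * n%:R))).
    by rewrite ler_wpM2l// Num.Theory.truncn_le.
  rewrite mulrA ler_wpM2r// /rho mulrCA ler_piMr ?(ltW lam0)//.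
  by rewrite ler_pdivrMr ?ltr_wpDl// mul1r lerDl.
move=> g glt; apply: Hys; apply/(wballP _ _ genS).
by rewrite Num.Theory.truncn_ge_nat// ltW.
Qed.

Section Contradiction.
Variable f : G -> R.
Hypotheses (cf : continuous f) (f1 : forall g, `|f g| <= 1) (harm : mu_harmonic mu f).
Hypothesis f_one : f 1%g = 0.

(** The lower bound s2 on the second moment of f is stated for all
    classifications at once, as the classification is chosen after s2. *)
Lemma variance_pos s : S s -> f s != 0 -> exists2 s2 : R, 0 < s2 <= 1 &
  forall (K : finType) (c : G -> K) (v : K -> R),
    (forall k, measurable (c @^-1` [set k] : set (borel G))) ->
    (forall k, 0 <= v k) ->
    (forall h, S h -> f h ^+ 2 <= v (c h)) ->
    s2 <= \sum_k class_mass mu c k * v k.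
Proof.
move=> Ss fs0; pose d := `|f s| / 2.
have d0 : 0 < d by rewrite divr_gt0// normr_gt0.
pose U := [set g | d < `|f g|].
have oU : open U.
  apply: (@open_comp _ _ (fun g => `|f g|) [set x | d < x]).
    by move=> g _; apply: (@continuous_comp _ _ _ f (fun x : R => `|x|)); [exact:
      cf|exact: norm_continuous].
  exact: open_gt.
have Us : U s by rewrite /U /= /d ltr_pdivrMr// ltr_pMr ?normr_gt0// ltr1n.
have muU := Ss U oU Us.
have mU := open_borel_measurable oU.
have finU : mu U \is a fin_num by rewrite fin_num_measure.
exists (d ^+ 2 * fine (mu U)).
  rewrite mulr_gt0 ?exprn_gt0 ?fine_gt0//=; last first.
    by rewrite muU/=; apply: le_lt_trans (probability_le1 mu mU) _; exact: ltry.
  rewrite -[leRHS]mulr1 ler_pM ?sqr_ge0 ?fine_ge0//.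
    by rewrite expr_le1// ?ltW// /d ltr_pdivrMr// mul1r (le_lt_trans (f1 s))// ltr1n.
  by rewrite -lee_fin fineK// probability_le1.
move=> K c v mc v0 fv; rewrite -lee_fin EFinM fineK//.
have -> : ((d ^+ 2)%:E * mu U = \int[mu]_x ((d ^+ 2)%:E * (\1_U x)%:E))%E.
  rewrite ge0_integralZl_EFin//.
  - by rewrite integral_indic// setIT.
  - by apply/measurable_EFinP; exact: measurable_indic.
  - exact: sqr_ge0.
apply: (integral_le_class mc mS S1) => //.
  by move=> x; rewrite mule_ge0 ?lee_fin ?sqr_ge0.
move=> h Sh; rewrite indicE; case: (boolP (h \in U)) => [/set_mem Uh|_] /=; last first.
  by rewrite mule0 lee_fin v0.
rewrite mule1 lee_fin; apply: le_trans (fv h Sh).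
by rewrite -[leRHS]real_normK ?num_real// lerXn2r ?nnegrE ?normr_ge0 ?(ltW d0)// ltW.
Qed.

(** Adding 1 makes f nonnegative, as the comparison of integrals with sums over
    classes requires. *)
Lemma harmonic_classified (K : finType) (c : G -> K) (t : K -> G) (eta : R) x :
  (forall k, measurable (c @^-1` [set k] : set (borel G))) ->
  (forall h, S h -> `|f (x * h)%g - f (x * t (c h))%g| <= eta) ->
  `|\sum_k class_mass mu c k * f (x * t k)%g - f x| <= eta.
Proof.
move=> mc osc; have H := harmonic_affine 1 1 x cf f1 harm 1%g.
have {}H : (\int[mu]_h (1 + f (x * h)%g)%:E = (1 + f x)%:E)%E.
  rewrite -[f x]mul1r -{2}[x]mulg1 -H /markov_op; apply: eq_integral => h _ /=.
  by rewrite mul1r mul1g.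
have pos g : 0 <= 1 + f g by have := f1 g; rewrite ler_norml => /andP[? _]; lra.
have p1 := class_mass_sum1 mu mc.
have sumE a : \sum_k class_mass mu c k * (1 + f (x * t k)%g + a) =
    1 + \sum_k class_mass mu c k * f (x * t k)%g + a.
  under eq_bigr do rewrite !mulrDr.
  by rewrite !big_split /= -!big_distrl /= p1 !mul1r.
have [s0 Ss0] := Sne.
have eta0 : 0 <= eta by apply: le_trans (osc s0 Ss0).
have up := integral_le_class mc mS S1 (g := fun h : borel G => (1 + f (x * h)%g)%:E)
  (v := fun k => 1 + f (x * t k)%g + eta).
have lo := integral_ge_class mc mS S1 (g := fun h : borel G => (1 + f (x * h)%g)%:E)
  (v := fun k => 1 + f (x * t k)%g + - eta).
rewrite !sumE !H !lee_fin in up lo.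
rewrite ler_norml; apply/andP; split.
  have : 1 + f x <= 1 + \sum_k class_mass mu c k * f (x * t k)%g + eta.
    apply: up => [h|k|h Sh]; first by rewrite lee_fin.
      by rewrite addr_ge0.
    by rewrite lee_fin; have := osc h Sh; rewrite ler_norml => /andP[? ?]; lra.
  by lra.
have : 1 + \sum_k class_mass mu c k * f (x * t k)%g - eta <= 1 + f x.
  apply: lo => [h|h Sh]; first by rewrite lee_fin.
  by rewrite lee_fin; have := osc h Sh; rewrite ler_norml => /andP[? ?]; lra.
by lra.
Qed.

(** The three costs of harmonic_vanishes add up to s2^2 / 64, less than the gain
    s2^2 / 48. *)
Fact exponent_balance (s2 x : R) : 0 < s2 -> 0 <= x ->
  expR (- (s2 / 24 * x * (s2 / 2))) *
  (1 + expR (s2 / 24 * (s2 / 8) * x) * expR (s2 / 24 * x * (s2 / 8)) *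
     expR (3 * (s2 / 24) ^+ 2 * x)) <= 2.
Proof.
move=> s20 x0; rewrite mulrDr mulr1 -!expRD.
have y0 : 0 <= s2 * s2 * x by rewrite !mulr_ge0// ltW.
have -> : - (s2 / 24 * x * (s2 / 2)) = - (s2 * s2 * x / 48) by field.
have -> : s2 / 24 * (s2 / 8) * x + s2 / 24 * x * (s2 / 8) + 3 * (s2 / 24) ^+ 2 * x =
  s2 * s2 * x / 64 by field.
have <- : expR 0 + expR 0 = 2 :> R by rewrite expR0.
by apply: lerD; rewrite ler_expR; lra.
Qed.

(** The variance is at least s2, so the score has mean at least about s2 n; the
    target is tau = s2 / 2 per step.  The parameter lam = s2 / 24 makes the Gaussian cost
    3 lam^2 equal to lam s2 / 8; the oscillation dl and the covering rate cost
    lam s2 / 8 each.  These three costs stay below lam tau, so the right side of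
    score_contradiction is at most 2 while the left side is at least 3. *)
Lemma harmonic_vanishes s : S s -> f s = 0.
Proof.
move=> Ss; apply: contrapT => /eqP fs0.
have [s2 /andP[s20 s21] var] := variance_pos Ss fs0.
pose lam := s2 / 24; pose dl := s2 / 8.
have lam0 : 0 < lam by rewrite divr_gt0.
have dl0 : 0 < dl by rewrite divr_gt0.
have nearU := harmonic_right_uniform cf f1 harm dl0 mu_translate.
have ldl0 : 0 < lam * dl by rewrite mulr_gt0.
have [rho rho0 cover] := covering_count nearU ldl0.
have e0 : 0 < rho * s2 / 16 by rewrite !(divr_gt0, mulr_gt0).
have [phi [A [cphi phi_ge A0 HA]]] := majorant e0.
have ls0 : 0 < lam * s2 / 4 by rewrite !(divr_gt0, mulr_gt0).
have [n [n_gt0 nA nbig]] : exists n : nat, [/\ (0 < n)%N, A + 1 <= rho * s2 / 16 * n%:R &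
    2 <= lam * s2 / 4 * n%:R].
  have [N _ HN] := filterI (nbhs_infty_gt 0) (filterI (eventually_small (A + 1) e0)
    (eventually_small 2 ls0)).
  by have [? [? ?]] := HN N (leqnn N); exists N.
have phi0 g : 0 <= phi g by apply: le_trans (phi_ge g).
pose eta := lam / n.+1%:R.
have eta0 : 0 < eta by rewrite divr_gt0.
have neta : n.+1%:R * eta = lam by rewrite mulrC divfK.
have etalam : eta <= lam by rewrite ler_pdivrMr// ler_peMr ?(ltW lam0)// ler1n.
pose F1 (z : G * G) := f (z.2 * z.1)%g.
pose F2 (z : G * G) := f (z.2 * z.1)%g ^+ 2.
pose F3 (z : G * (G * G)) := phi (z.2.1 * z.1 * z.2.2)%g.
have cF1 : continuous F1.
  move=> z; apply: (@continuous_comp _ _ _ (fun z : G * G => z.2 * z.1)%g f); last exact: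
    cf.
  exact: (mulg_cont2 (@snd_cont G G) (@fst_cont G G)).
have cF2 : continuous F2.
  by move=> z; apply: (@continuous_comp _ _ _ F1 (fun x : R => x ^+ 2)); [exact:
    cF1|exact: exprn_continuous].
have cF3 : continuous F3 by exact: sandwich_continuous.
have cB1 : compact (wball S n) by exact: wball_compact.
have cB : compact (wball S n `*` wball S n) by exact: compact_setX.
have [r [c [t [mc St osc]]]] := finite_classification hG compS Sne
  (equicontinuous_onU (equicontinuous_on_param (S := S) cF1 cB1)
  (equicontinuous_onU (equicontinuous_on_param (S := S) cF2 cB1)
     (equicontinuous_on_param (S := S) cF3 cB))) eta0.
pose p := class_mass mu c.
have p0 j : 0 <= p j by exact: class_mass_ge0.
have p1 : \sum_j p j = 1 by exact: class_mass_sum1.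
have harmp x : wball S n x -> `|\sum_k p k * f (x * t k)%g - f x| <= eta.
  move=> Bx; apply: harmonic_classified => // h Sh.
  by apply: (osc h (fun h => F1 (h, x)) Sh); left; exists x.
have varp : s2 - eta <= \sum_k p k * f (t k) ^+ 2.
  have := var _ c (fun k => f (t k) ^+ 2 + eta) mc.
  under eq_bigr do rewrite mulrDr.
  rewrite big_split /= -big_distrl /= -/p p1 mul1r lerBlDr; apply => [k|h Sh].
    by rewrite addr_ge0 ?sqr_ge0// ltW.
  have : `|F2 (h, 1%g) - F2 (t (c h), 1%g)| <= eta.
    apply: (osc h (fun h => F2 (h, 1%g)) Sh); right; left; exists 1%g => //.
    exact: wball1.
  by rewrite /F2 /= !mul1g ler_norml => /andP[? ?]; lra.
have meanp : `|\sum_k p k * f (t k)| <= lam.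
  have := harmp 1%g (wball1 S n); rewrite f_one subr0 => H.
  apply: le_trans etalam; apply: le_trans H.
  by rewrite le_eqVlt; apply/orP; left; apply/eqP; congr `|_|; apply: eq_bigr => k _;
    rewrite mul1g.
have phip : wexp p n (fun w => phi (wprod t w)) <= rho * s2 / 8 * n%:R.
  have oscT h x y : S h -> wball S n x -> wball S n y ->
      `|phi (x * h * y)%g - phi (x * t (c h) * y)%g| <= eta.
    move=> Sh Bx By; apply: (osc h (fun h => F3 (h, (x, y))) Sh).
    by right; right; exists (x, y).
  have := wexp_le_iter_markov mS S1 phi0 mc oscT St (leqnn (0 + n)) (wball1 S 0).
  move=> /le_trans /(_ (HA n)); rewrite lee_fin.
  under eq_wexp do rewrite mul1g.
  have : n%:R * eta <= 1.
    apply: (@le_trans _ _ (n.+1%:R * eta)); first by rewrite ler_wpM2r ?ler_nat// ltW.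
    by rewrite neta /lam; lra.
  by move: nA; rewrite -/p; lra.
have scorep : n%:R * (s2 - lam) <= wexp p n (fun w => score t f w (wprod t w)).
  apply: (@le_trans _ _ (n%:R * (\sum_k p k * f (t k) ^+ 2 - n%:R * eta))).
    rewrite ler_wpM2l//; move: varp; rewrite -neta -natr1 mulrDl mul1r; lra.
  apply: score_mean => // m k mn.
  have jm : (1 + m <= n)%N by rewrite add1n.
  have Bt j x k' : wball S j x -> wball S j.+1 (x * t k')%g.
    by move=> Bx; rewrite -addn1; apply: wball_mul Bx _; apply: wball_gen.
  have := wexp_near_harmonic p0 p1 Bt harmp (fun j x Bx jn => wball_sub jn Bx) jm
    (wball_gen (St k)).
  move=> /le_trans; apply; rewrite ler_wpM2r ?(ltW eta0)// ler_nat; exact: ltnW.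
have [ys ysN Hys] := cover n.
have lam12 : 0 <= lam <= 2^-1 by rewrite (ltW lam0)/= /lam; lra.
have cov w : size w = n -> n%:R <= phi (wprod t w) / rho \/
    exists2 y, y \in ys & forall z, `|f (z * wprod t w)%g - f (z * y)%g| <= dl.
  move=> sw; have [big|small] := leP (rho * n%:R) (word_length S (wprod t w))%:R.
    by left; rewrite ler_pdivlMr// mulrC (le_trans big).
  right; have [y yys [u Uu ->]] := Hys _ small.
  by exists y => // z; rewrite mulgA; exact: Uu.
have := score_contradiction p0 p1 f1 (psi := fun g => phi g / rho) (s2 / 2)
  (fun g => divr_ge0 (phi0 g) (ltW rho0)) lam12 meanp cov.
apply/negP; rewrite -ltNge.
apply: (@le_lt_trans _ _ 2).
  apply: le_trans (exponent_balance s20 (ler0n R n)).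
  rewrite ler_wpM2l ?expR_ge0// lerD2l.
  have l3 : 0 <= 1 + 3 * lam ^+ 2 by rewrite addr_ge0// mulr_ge0// sqr_ge0.
  apply: ler_pM.
  - by rewrite mulr_ge0 ?expR_ge0.
  - exact: exprn_ge0.
  - by rewrite ler_wpM2r ?expR_ge0.
  - rewrite -/lam [X in expR X]mulrC expRM_natl lerXn2r ?nnegrE ?expR_ge0//.
    exact: expR_ge1Dx.
have -> : wexp p n (fun w => phi (wprod t w) / rho) = wexp p n (fun w => phi (wprod t w))
  / rho.
  by rewrite mulrC -wexpZ; apply: eq_wexp => w _; rewrite mulrC.
have psip : wexp p n (fun w => phi (wprod t w)) / rho <= s2 / 8 * n%:R.
  rewrite ler_pdivrMr//; apply: (le_trans phip).
  by rewrite le_eqVlt; apply/orP; left; apply/eqP; ring.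
have n1 : 1 <= n%:R :> R by rewrite ler1n.
have : lam * (n%:R * (s2 - lam) - s2 / 8 * n%:R - n%:R * (s2 / 2)) <=
  lam * (wexp p n (fun w => score t f w (wprod t w)) -
    wexp p n (fun w => phi (wprod t w)) / rho - n%:R * (s2 / 2)).
  by rewrite ler_wpM2l ?(ltW lam0)//; lra.
have : lam * s2 / 4 * n%:R <= lam * (n%:R * (s2 - lam) - s2 / 8 * n%:R - n%:R * (s2 / 2)).
  have -> : n%:R * (s2 - lam) - s2 / 8 * n%:R - n%:R * (s2 / 2) = n%:R * s2 / 3 by
    rewrite /lam; field.
  have := mulr_ge0 (mulr_ge0 (ltW lam0) (ltW s20)) (ler0n R n).
  lra.
lra.
Qed.
End Contradiction.

(** The difference between a translate of f and its value at 1, scaled to take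
    values in [-1, 1], vanishes on S. *)
Lemma zero_speed_liouville : liouville mu.
Proof.
move=> f cf [M fM] harm; exists (f 1%g).
have step x s : S s -> f (x * s)%g = f x.
  move=> Ss; have M0 : 0 <= M by apply: le_trans (fM 1%g).
  pose cc := (2 * (M + 1))^-1.
  have cc0 : 0 < cc by rewrite invr_gt0; lra.
  pose f' g := - (cc * f x) + cc * f (x * g)%g.
  have cf' : continuous f'.
    apply: affine_continuous => h.
    by apply: (@continuous_comp _ _ _ (fun h => x * h)%g f); [exact: mulgl_cont|exact: cf].
  have f'1 g : `|f' g| <= 1.
    rewrite /f' addrC -mulrBr normrM gtr0_norm// /cc mulrC ler_pdivrMr ?mul1r; last lra.
    by apply: (le_trans (ler_normB _ _)); have := fM (x * g)%g; have := fM x; lra.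
  have harm' : mu_harmonic mu f' by exact: harmonic_affine.
  have f'0 : f' 1%g = 0 by rewrite /f' mulg1 addNr.
  have := harmonic_vanishes cf' f'1 harm' f'0 Ss; rewrite /f' => /eqP.
  rewrite addrC subr_eq0 => /eqP /(mulfI _); apply; exact: lt0r_neq0.
move=> g; have [n Sn] := genS g.
have : forall x, f (x * g)%g = f x.
  elim: n g Sn => [|n IH] g; first by move=> /= -> x; rewrite mulg1.
  by move=> [s Ss [g' Sg' <-]] x; rewrite mulgA (IH g')// step.
by move=> /(_ 1%g); rewrite mul1g.
Qed.

End Liouville.

Theorem theorem5 (R : realType) (G : topGroupType)
    (hausdorffG : hausdorff_space G) (lcG : locally_compact [set: G])
    (mG : {measure set (borel G) -> \bar R}) (haar_mG : left_haar mG)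
    (T : set G) (compactT : compact T) (genT : generating T)
    (q : R) (q_gt1 : 1 < q) (q_le2 : q <= 2)
    (E : completeNormedModType R) (smoothE : uniformly_smooth E q)
    (pi : G -> {linear E -> E}) (rep_pi : continuous_isometric_rep pi)
    (b : G -> E) (cocycle_b : cocycle pi b)
    (rho_b : ((n%:R `^ q^-1)%:E / compression T b n)%E @[n --> \oo] --> 0%E)
    (mu : probability (borel G) R) (S : set G)
    (adapted_mu : coh_adapted mG S mu) (supp_mu : msupport mu = S) :
  is_drift mu S 0 /\ liouville mu.
Proof.
case: adapted_mu => -[compS genS] [mu_sym mu_mG _ [f [mf f0 f_dens _]] _].
rewrite -supp_mu in compS genS *.
have S1 := support_full hausdorffG haar_mG mu_mG compS genS.
have Sne : msupport mu !=set0 by exact: (support_nonempty hausdorffG haar_mG mu_mG compS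
  genS).
have q1 : 1 <= q by exact: ltW.
have majorant := speed_majorant hausdorffG compS S1 Sne mu_sym q1 smoothE rep_pi
  cocycle_b haar_mG genS compactT genT rho_b.
split; last first.
  apply: (zero_speed_liouville hausdorffG lcG compS S1 Sne genS majorant) => delta.
  exact: (measure_translate hausdorffG haar_mG mf f0 f_dens).
split; last exact: convolution_drift.
move=> d Omega P omega iid.
have e0 j : 0 < j.+1%:R^-1 :> R by rewrite invr_gt0.
have := ae_foralln (fun j => walk_ae_le hausdorffG compS S1 Sne genS majorant iid (e0 j)).
apply: filterS => x Hx; apply/cvgr0Pnorm_lt => eps eps0.
have [j je] : exists j : nat, j.+1%:R^-1 < eps.
  by have /ltr_add_invr[k] := eps0; rewrite add0r; exists k.
apply: filterS (Hx j) => n Hn; rewrite ger0_norm ?divr_ge0//.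
apply: le_lt_trans je; have [->|n0] := posnP n; first by rewrite invr0 mulr0 ltW.
by rewrite ler_pdivrMr// ltr0n.
Qed.
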